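(* Every commutative (real or complex) JB$^*$-triple $E$ is almost ternary weakly amenable, that is, the set $\mathcal{I}nn_t(E,E^* )$ of inner ternary derivations from $E$ to $E^*$ is a norm-dense subset of the set $\mathcal{D}_t(E,E^* )$ of all continuous ternary derivations from $E$ to $E^*$.
   Context: A complex (resp., real) Jordan triple is a complex (resp., real) vector space $E$ with a non-trivial triple product $\{\cdot,\cdot,\cdot\}$ that is bilinear and symmetric in the outer variables, conjugate linear (resp., linear) in the middle one, and satisfies $L(a,b)L(x,y)-L(x,y)L(a,b)=L(L(a,b)x,y)-L(x,L(b,a)y)$, where $L(x,y)z=\{x,y,z\}$. It is a Jordan Banach triple if $E$ is a Banach space and the product is continuous. It is commutative if $L(a,b)L(c,d)=L(c,d)L(a,b)$ for all $a,b,c,d\in E$. A (complex) JB$^*$-triple is a complex Jordan Banach triple such that each $L(a,a)$ is a hermitian operator with non-negative spectrum and $\|\{a,a,a\}\|=\|a\|^3$ for all $a$. A real JB$^*$-triple is a norm-closed real subtriple of a complex JB$^*$-triple. The dual $E^*$ is a Jordan triple $E$-module with the products $\{a,b,\varphi\}(x)=\{\varphi,b,a\}(x):=\varphi(\{b,a,x\})$ and $\{a,\varphi,b\}(x):=\overline{\varphi(\{a,x,b\})}$ for $a,b,x\in E$, $\varphi\in E^*$ (in the real case the conjugation is trivial). A ternary derivation $\delta:E\to E^*$ is a conjugate linear (linear, in the real case) map with $\delta\{a,b,c\}=\{\delta(a),b,c\}+\{a,\delta(b),c\}+\{a,b,\delta(c)\}$ for all $a,b,c\in E$. For $b\in E$,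 $\varphi\in E^*$, the map $\delta(b,\varphi)(a):=\{b,\varphi,a\}-\{\varphi,b,a\}$ is a ternary derivation; finite sums of such maps are called inner ternary derivations. The norm on $\mathcal{D}_t(E,E^* )$ is the operator norm. *)

(* Defs.v *)
From HB Require Import structures.
From mathcomp Require Import all_boot all_order all_algebra.
From mathcomp Require Import complex.
From mathcomp Require Import all_classical all_reals.
From mathcomp Require Import ereal topology normedtype sequences.

Set Implicit Arguments.
Unset Strict Implicit.
Unset Printing Implicit Defensive.

Import Order.TTheory GRing.Theory Num.Theory.
Import numFieldNormedType.Exports.

Local Open Scope classical_set_scope.
Local Open Scope ring_scope.

(* The real and the complex theory are developed together, over a scalar      *)
(* field K with a conjugation conj (the identity when K = R).  A norm takes   *)
(* its values in K, so re : K -> R recovers the real number it stands for     *)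
(* (the identity when K = R, the real part when K = R[i]).                    *)

Section OperatorNorm.
Variables (R : realType) (K : numFieldType) (V : normedModType K).

(* The supremum is taken in \bar R: it is +oo on unbounded maps, whereas sup  *)
(* in R would return a junk value.                                            *)
Definition opnorm (W : Type) (N : W -> \bar R) (T : V -> W) : \bar R :=
  ereal_sup [set N (T x) | x in [set x : V | `|x| <= 1]].

End OperatorNorm.

Section JordanTriples.
Variables (K : numFieldType) (conj : K -> K).
Variables (V : normedModType K) (tp : V -> V -> V -> V).

Record is_jordan_triple : Prop := IsJordanTriple {
  tp_nontrivial : exists a b c, tp a b c != 0;
  tp_outer_linear : forall b c, linear (fun a => tp a b c);
  tp_outer_sym : forall a b c, tp a b c = tp c b a;
  tp_middle_conj_linear : forall a c k (x y : V),
    tp a (k *: x + y) c = conj k *: tp a x c + tp a y c;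
  tp_jordan_identity : forall a b x y z,
    tp a b (tp x y z) - tp x y (tp a b z)
    = tp (tp a b x) y z - tp x (tp b a y) z }.

Definition is_jordan_normed_triple : Prop :=
  is_jordan_triple /\ continuous (fun p : V * V * V => tp p.1.1 p.1.2 p.2).

Definition is_commutative_triple : Prop :=
  forall a b c d z, tp a b (tp c d z) = tp c d (tp a b z).

End JordanTriples.

Section ComplexJBStarTriples.
Variables (R : realType) (E : completeNormedModType R[i]).

Definition is_bounded_operator (T : E -> E) : Prop :=
  linear T /\ continuous T.

Definition opexp (T : E -> E) (x : E) : E :=
  limn (series (fun n => (n`!%:R : R[i])^-1 *: iter n T x)).

Definition is_hermitian (T : E -> E) : Prop :=
  is_bounded_operator T /\
  forall t : R,
    opnorm (fun y : E => (complex.Re `|y|)%:E)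
           (opexp (fun x => (0 +i* t)%C *: T x)) = 1%E.

Definition spectrum (T : E -> E) : set R[i] :=
  [set lam | ~ exists2 S : E -> E, is_bounded_operator S &
      (forall x, S (lam *: x - T x) = x) /\
      (forall x, lam *: S x - T (S x) = x)].

(* In R[i], 0 <= lam means that lam is real and non-negative. *)
Record is_JBstar_triple (tp : E -> E -> E -> E) : Prop := IsJBStarTriple {
  JBstar_jordan_banach : is_jordan_normed_triple (@conjc R) tp;
  JBstar_hermitian : forall a, is_hermitian (tp a a);
  JBstar_spectrum : forall a lam, spectrum (tp a a) lam -> 0 <= lam;
  JBstar_norm : forall a, `|tp a a a| = `|a| ^+ 3 }.

End ComplexJBStarTriples.

(* A norm-closed real subtriple of a complex JB*-triple F is presented as a   *)
(* real normed space E with its inclusion j : E -> F.                         *)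
Definition is_real_JBstar_triple (R : realType) (E : normedModType R)
    (tp : E -> E -> E -> E) : Prop :=
  is_jordan_normed_triple idfun tp /\
  exists (F : completeNormedModType R[i]) (tpF : F -> F -> F -> F) (j : E -> F),
    [/\ is_JBstar_triple tpF,
        forall (r : R) (x y : E), j (r *: x + y) = (r%:C)%C *: j x + j y,
        forall x, `|j x| = (`|x|%:C)%C,
        forall a b c, j (tp a b c) = tpF (j a) (j b) (j c) &
        closed (range j)].

Section TernaryDerivations.
Variables (R : realType) (K : numFieldType) (re : K -> R) (conj : K -> K).
Variables (V : normedModType K) (tp : V -> V -> V -> V).

(* Elements of the dual are plain functions satisfying is_dual. *)
Definition is_dual (phi : V -> K) : Prop :=
  scalar phi /\ continuous (phi : V -> K^o).

Definition dual_norm (phi : V -> K) : \bar R :=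
  opnorm (fun k : K => (re `|k|)%:E) phi.

(* {a, b, phi} *)
Definition dual_tp_r (a b : V) (phi : V -> K) : V -> K :=
  fun x => phi (tp b a x).

(* {phi, b, a} *)
Definition dual_tp_l (phi : V -> K) (b a : V) : V -> K :=
  dual_tp_r a b phi.

(* {a, phi, b} *)
Definition dual_tp_m (a : V) (phi : V -> K) (b : V) : V -> K :=
  fun x => conj (phi (tp a x b)).

Record is_ternary_derivation (D : V -> V -> K) : Prop := IsTernaryDerivation {
  tder_dual : forall a, is_dual (D a);
  tder_conj_linear : forall k a b x,
    D (k *: a + b) x = conj k * D a x + D b x;
  tder_leibniz : forall a b c x,
    D (tp a b c) x = dual_tp_l (D a) b c x + dual_tp_m a (D b) c x
                     + dual_tp_r a b (D c) x }.

(* Continuity from the norm of V to the norm of the dual. *)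
Definition is_norm_continuous (D : V -> V -> K) : Prop :=
  forall (a : V) (e : R), 0 < e ->
    \forall b \near a, (dual_norm (fun x => (D b x - D a x)%R) < e%:E)%E.

Definition continuous_ternary_derivations : set (V -> V -> K) :=
  [set D | is_ternary_derivation D /\ is_norm_continuous D].

Definition inner_tder (b : V) (phi : V -> K) : V -> V -> K :=
  fun a x => dual_tp_m b phi a x - dual_tp_l phi b a x.

Definition inner_ternary_derivations : set (V -> V -> K) :=
  [set D | exists (n : nat) (b : 'I_n -> V) (phi : 'I_n -> V -> K),
      (forall i, is_dual (phi i)) /\
      (forall a x, D a x = \sum_(i < n) inner_tder (b i) (phi i) a x)].

Definition almost_ternary_weakly_amenable : Prop :=
  inner_ternary_derivations `<=` continuous_ternary_derivations /\
  forall D, continuous_ternary_derivations D ->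
    forall e : R, 0 < e -> exists2 d, inner_ternary_derivations d &
      (opnorm dual_norm (fun a x => (D a x - d a x)%R) < e%:E)%E.

End TernaryDerivations.

(* Main.v *)
Require Import Defs.
From HB Require Import structures.
From mathcomp Require Import all_boot all_order all_algebra.
From mathcomp Require Import complex.
From mathcomp Require Import ring lra.
From mathcomp Require Import all_classical all_reals.
From mathcomp Require Import ereal topology normedtype sequences.

(** A commutative triple behaves like the functions on a locally compact space
    that are equivariant for a circle action, with the product of [a], the
    conjugate of [b], and [c].  There a ternary derivation is integration of
    the conjugate of [a] times [x] against [i] times a real measure on the orbit
    space, and it is inner up to a small error because that measure is nearly
    carried by the set where finitely many elements do not vanish.  The proof
    follows this picture without constructing the space or the measure.

    Taking real parts, a derivation becomes a bounded real bilinear form [beta]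
    on a real triple, and the real and the complex case become one.  The
    five-fold products are symmetric in the linear and in the conjugate
    variables, so the operators [t e f] generate a commutative algebra of
    multipliers.  The identity between the norm of a cube and the cube of the
    norm shows that unitary multipliers are contractions
    ([unitary_contraction], [unitary_pair_contraction]).

    The form [beta] is local: [beta (t e f a) x = beta a (t f e x)].  Indeed the
    difference of the two sides is the rate at which [beta] changes under
    conjugation by the Cayley transform of the symmetric operator [t e e], or of
    the skew operator [t e f - t f e].  The powers of a unitary are bounded, and
    a bounded orbit cannot drift ([winding_eq0], [defect_eq0]).

    Locality makes an inner form equal to [beta] composed with a multiplier on
    the right ([inner_form_multiplier]).  If [beta a0 x0] nearly attains the norm
    of [beta] and [w] is a cut-off supported where [a0] and [x0] are small, then
    [beta] is small on the range of [w]: otherwise [a0] and [x0] could be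
    perturbed there to exceed the norm.  The remaining part of [beta] is a sum of
    two inner forms ([cutoff], [beta_near_inner]). *)

Set Implicit Arguments.
Unset Strict Implicit.
Unset Printing Implicit Defensive.

Import Order.TTheory GRing.Theory Num.Theory.
Import numFieldNormedType.Exports.
Local Open Scope classical_set_scope.
Local Open Scope ring_scope.

(** * Elementary real estimates *)

Lemma ler_of_pow_bounded (R : realType) (x y K : R) :
  0 <= y -> (forall n, x ^+ (3 ^ n) <= K * y ^+ (3 ^ n)) -> x <= y.
Proof.
move=> y0 H; rewrite leNgt; apply/negP => yx.
have x0 : 0 < x by exact: le_lt_trans yx.
have := H 0%N; rewrite expn0 !expr1 => H0.
have y1 : 0 < y.
  rewrite lt_neqAle y0 andbT; apply/eqP => yE.
  by move: H0; rewrite -yE mulr0 leNgt x0.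
pose d := x / y - 1.
have d0 : 0 < d by rewrite /d subr_gt0 ltr_pdivlMr // mul1r.
have bern n : 1 + n%:R * d <= (x / y) ^+ n.
  elim: n => [|n IH]; first by rewrite mul0r addr0 expr0.
  move: IH; have -> : x / y = 1 + d by rewrite /d addrC subrK.
  move=> IH.
  rewrite exprS.
  apply: le_trans (_ : (1 + d) * (1 + n%:R * d) <= _); last first.
    by apply: ler_wpM2l => //; rewrite addr_ge0 // ltW.
  rewrite -natr1.
  have : 0 <= n%:R * d ^+ 2 by rewrite mulr_ge0 ?sqr_ge0.
  nra.
have bd n : 1 + n%:R * d <= K.
  apply: le_trans (_ : 1 + (3 ^ n)%:R * d <= _).
    by rewrite lerD2l ler_pM2r // ler_nat ltnW // ltn_expl.
  apply: le_trans (bern _) _.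
  by rewrite expr_div_n ler_pdivrMr ?exprn_gt0 // H.
have K1 : 1 <= K by have := bd 0%N; rewrite mul0r addr0.
have Kd : 0 <= K / d by rewrite divr_ge0 // ltW // (lt_le_trans ltr01).
have := bd (Num.bound (K / d)); have := archi_boundP Kd.
by rewrite ltr_pdivrMr // => H1 H2; lra.
Qed.

Lemma ler_of_halving (R : realType) (x y : R) :
  (forall n, x <= y + 2^-1 ^+ n) -> x <= y.
Proof.
move=> H; apply/ler_addgt0Pr => e e0.
have := archi_boundP (x := e^-1); rewrite invr_ge0 ltW // => /(_ isT).
set n := Num.bound _ => Hn.
apply: le_trans (H n) _; rewrite lerD2l exprVn invf_ple ?posrE ?exprn_gt0 //.
by rewrite (le_trans (ltW Hn)) // -natrX ler_nat ltnW // ltn_expl.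
Qed.

(** Along an orbit [f] grows linearly with slope [k z], so a bounded orbit forces
    the slope to vanish.  It is applied to conjugation by a unitary [U]: the
    derivation property makes a derivation form change by a fixed amount each
    time [U] is applied to both of its arguments. *)
Lemma winding_eq0 (R : realType) (X : Type) (U : X -> X) (f k : X -> R) (z : X)
    (M : R) :
  (forall u, f (U u) = f u + k u) -> (forall u, k (U u) = k u) ->
  (forall n, `|f (iter n U z)| <= M) -> k z = 0.
Proof.
move=> fU kU fM.
have kn n : k (iter n U z) = k z by elim: n => //= n IH; rewrite kU.
have fn n : f (iter n U z) = f z + n%:R * k z.
  elim: n => [|n IH]; first by rewrite mul0r addr0.
  by rewrite iterS fU IH kn -natr1 mulrDl mul1r addrA.
apply/eqP/negPn/negP => k0.
have n0 : 0 < `|k z| by rewrite normr_gt0.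
have M0 : 0 <= M by apply: le_trans (fM 0%N).
have := archi_boundP (x := (M + M) / `|k z|).
rewrite divr_ge0 ?addr_ge0 // => /(_ isT); set n := Num.bound _.
rewrite ltr_pdivrMr // => Hn.
have : n%:R * `|k z| <= M + M.
  have -> : n%:R * `|k z| = `|f (iter n U z) - f z|.
    by rewrite fn addrC addKr normrM ger0_norm.
  by rewrite (le_trans (ler_normB _ _)) // lerD // ?fM // (fM 0%N).
by rewrite leNgt Hn.
Qed.

(** * Five-fold products in a commutative triple *)

Section CommutingTriple.
Variables (V : zmodType) (t : V -> V -> V -> V).

Record commuting_triple : Prop := CommutingTriple {
  ct_sym : forall a b c, t a b c = t c b a;
  ct_jordan : forall a b x y z,
    t a b (t x y z) - t x y (t a b z) = t (t a b x) y z - t x (t b a y) z;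
  ct_comm : forall a b c d z, t a b (t c d z) = t c d (t a b z) }.

Hypothesis ht : commuting_triple.

(** With [t_middle] and [t_swap] this says that a five-fold product depends only
    on the three elements in linear position and on the two in conjugate
    position, each taken without order. *)
Lemma t_outer a b c d x : t (t a b c) d x = t a b (t c d x).
Proof. by rewrite (ct_sym ht _ d) (ct_comm ht) (ct_sym ht x). Qed.

Lemma t_middle a b c d x : t c (t b a d) x = t a b (t c d x).
Proof.
have := ct_jordan ht a b c d x; rewrite (ct_comm ht) subrr => /eqP.
by rewrite eq_sym subr_eq0 t_outer => /eqP <-; rewrite (ct_comm ht).
Qed.

Lemma t_swap a b c d x : t a b (t c d x) = t a d (t c b x).
Proof. by rewrite -t_middle (ct_sym ht b) t_middle. Qed.

End CommutingTriple.

(** * Commutative triples with a cubic norm *)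

Section CommutativeTriple.
Variables (R : realType) (V : lmodType R) (t : V -> V -> V -> V).
Variables (N : V -> R) (N2 : V -> V -> R).

(** [N2 x y] is the norm of [x + i y] in a complex triple that contains [V]
    isometrically; its five axioms are all that is used about that triple.
    Completeness enters through the solvability of [z = y + T z] for a linear
    contraction [T]. *)
Record commutative_JB : Prop := CommutativeJB {
  cj_linl : forall b c, linear (fun a => t a b c);
  cj_linm : forall a c, linear (fun b => t a b c);
  cj_triple : commuting_triple t;
  cj_normD : forall x y, N (x + y) <= N x + N y;
  cj_normZ : forall r x, N (r *: x) = `|r| * N x;
  cj_norm_eq0 : forall x, N x = 0 -> x = 0;
  cj_cube : forall x, N (t x x x) = N x ^+ 3;
  cj_bound : exists2 C : R, 0 <= C & forall a b c, N (t a b c) <= C * N a * N b * N c;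
  cj_complete : forall (T : V -> V) (q : R), linear T -> 0 <= q < 1 ->
    (forall x, N (T x) <= q * N x) -> forall y, exists z, z = y + T z;
  cj_complexl : forall x y, N x *+ 2 <= N2 x y + N2 x (- y);
  cj_complexr : forall x y, N y *+ 2 <= N2 x y + N2 x (- y);
  cj_complex_le : forall x y, N2 x y <= N x + N y;
  cj_complex_ge0 : forall x y, 0 <= N2 x y;
  cj_complex_cube : forall x y,
    N2 x y ^+ 3 = N2 (t x x x + t x y y *+ 2 - t y x y)
                     (t x x y *+ 2 - t x y x + t y y y) }.

Hypothesis hV : commutative_JB.

Let ht : commuting_triple t := cj_triple hV.

Lemma norm0 : N 0 = 0.
Proof. by have := cj_normZ hV 0 0; rewrite scale0r normr0 mul0r. Qed.

Lemma normN x : N (- x) = N x.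
Proof. by rewrite -scaleN1r (cj_normZ hV) normrN normr1 mul1r. Qed.

Lemma norm_ge0 x : 0 <= N x.
Proof.
have := cj_normD hV x (- x); rewrite subrr norm0 normN -mulr2n.
by rewrite pmulrn_lge0.
Qed.

Lemma normB x y : N (x - y) <= N x + N y.
Proof. by rewrite -[N y]normN (cj_normD hV). Qed.

Lemma tDl a a' b c : t (a + a') b c = t a b c + t a' b c.
Proof. by have := cj_linl hV b c 1 a a'; rewrite !scale1r. Qed.
Lemma tDm a b b' c : t a (b + b') c = t a b c + t a b' c.
Proof. by have := cj_linm hV a c 1 b b'; rewrite !scale1r. Qed.
Lemma tDr a b c c' : t a b (c + c') = t a b c + t a b c'.
Proof. by rewrite !(ct_sym ht a b) tDl. Qed.
Lemma t0l b c : t 0 b c = 0.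
Proof. by have /eqP := tDl 0 0 b c; rewrite addr0 -subr_eq subrr => /eqP. Qed.
Lemma t0m b c : t b 0 c = 0.
Proof. by have /eqP := tDm b 0 0 c; rewrite addr0 -subr_eq subrr => /eqP. Qed.
Lemma tZl k a b c : t (k *: a) b c = k *: t a b c.
Proof. by have := cj_linl hV b c k a 0; rewrite !addr0 t0l addr0. Qed.
Lemma tZm k a b c : t a (k *: b) c = k *: t a b c.
Proof. by have := cj_linm hV a c k b 0; rewrite !addr0 t0m addr0. Qed.
Lemma tZr k a b c : t a b (k *: c) = k *: t a b c.
Proof. by rewrite !(ct_sym ht a b) tZl. Qed.
Lemma tNl a b c : t (- a) b c = - t a b c.
Proof. by rewrite -(scaleN1r a) tZl scaleN1r. Qed.
Lemma tNm a b c : t a (- b) c = - t a b c.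
Proof. by rewrite -(scaleN1r b) tZm scaleN1r. Qed.

Lemma norm_gt0 x : x != 0 -> 0 < N x.
Proof.
move=> x0; rewrite lt_neqAle norm_ge0 andbT eq_sym.
by apply: contra_neq x0; exact: (cj_norm_eq0 hV).
Qed.

Lemma cube_eq0 x : t x x x = 0 -> x = 0.
Proof.
move=> x0; apply: (cj_norm_eq0 hV); have := cj_cube hV x; rewrite x0 norm0.
by move=> /esym /eqP; rewrite expf_eq0 /= => /eqP.
Qed.

(** The cube of the difference of [x] and [y] vanishes, hence so does its norm. *)
Lemma t_inj x y : (forall b c, t x b c = t y b c) -> x = y.
Proof.
move=> xy; apply/eqP; rewrite -subr_eq0; apply/eqP/cube_eq0.
by rewrite tDl tNl xy subrr.
Qed.

(** * Multipliers *)

(** In the model of functions on a space with a circle action the multipliers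
    are the multiplications by invariant functions, and the adjoint is the
    complex conjugate function. *)
Record multiplier (T : V -> V) : Prop := Multiplier {
  mul_linear : linear T;
  mul_t : forall a b c, T (t a b c) = t (T a) b c;
  mul_bounded : exists2 K : R, 0 <= K & forall x, N (T x) <= K * N x }.

Definition adjoint (T S : V -> V) := forall a b c, t a (T b) c = S (t a b c).

Definition selfadjoint T := multiplier T /\ adjoint T T.

Section MultiplierTheory.
Variables (T : V -> V) (hT : multiplier T).

Lemma mulD x y : T (x + y) = T x + T y.
Proof. by have := mul_linear hT 1 x y; rewrite !scale1r. Qed.
Lemma mul0 : T 0 = 0.
Proof. by have /eqP := mulD 0 0; rewrite addr0 -subr_eq subrr => /eqP. Qed.
Lemma mulZ k x : T (k *: x) = k *: T x.
Proof. by have := mul_linear hT k x 0; rewrite mul0 !addr0. Qed.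
Lemma mulN x : T (- x) = - T x.
Proof. by rewrite -(scaleN1r x) mulZ scaleN1r. Qed.
Lemma mulB x y : T (x - y) = T x - T y.
Proof. by rewrite mulD mulN. Qed.
Lemma mul_tr a b c : T (t a b c) = t a b (T c).
Proof. by rewrite (ct_sym ht) (mul_t hT) (ct_sym ht). Qed.

End MultiplierTheory.

Lemma multiplier_comm T S x : multiplier T -> multiplier S -> T (S x) = S (T x).
Proof.
move=> hT hS; apply: t_inj => b c.
rewrite -!(mul_t hT) -!(mul_t hS) -(mul_t hT).
by rewrite (mul_tr hS) (mul_t hT) -(mul_tr hS) -(mul_t hT).
Qed.

Lemma multiplier_id : multiplier id.
Proof. by split=> //; exists 1 => // x; rewrite mul1r. Qed.

Lemma multiplierD T S : multiplier T -> multiplier S ->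
  multiplier (fun x => T x + S x).
Proof.
move=> hT hS; split.
- move=> k x y; rewrite (mulD hT) (mulD hS) (mulZ hT) (mulZ hS) scalerDr.
  by rewrite addrACA.
- by move=> a b c; rewrite (mul_t hT) (mul_t hS) tDl.
- have [K K0 HK] := mul_bounded hT; have [L L0 HL] := mul_bounded hS.
  exists (K + L); first exact: addr_ge0.
  by move=> x; rewrite mulrDl (le_trans (cj_normD hV _ _)) // lerD.
Qed.

Lemma multiplierZ k T : multiplier T -> multiplier (fun x => k *: T x).
Proof.
move=> hT; split.
- by move=> l x y; rewrite (mulD hT) (mulZ hT) scalerDr !scalerA mulrC.
- by move=> a b c; rewrite (mul_t hT) tZl.
- have [K K0 HK] := mul_bounded hT.
  exists (`|k| * K); first exact: mulr_ge0.
  by move=> x; rewrite (cj_normZ hV) -mulrA ler_wpM2l.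
Qed.

Lemma multiplierN T : multiplier T -> multiplier (fun x => - T x).
Proof.
move=> /(multiplierZ (-1)); congr multiplier.
by apply/funext => x; rewrite scaleN1r.
Qed.

Lemma multiplier_comp T S : multiplier T -> multiplier S ->
  multiplier (fun x => T (S x)).
Proof.
move=> hT hS; split.
- by move=> k x y; rewrite (mul_linear hS) (mul_linear hT).
- by move=> a b c; rewrite (mul_t hS) (mul_t hT).
- have [K K0 HK] := mul_bounded hT; have [L L0 HL] := mul_bounded hS.
  exists (K * L); first exact: mulr_ge0.
  by move=> x; rewrite -mulrA (le_trans (HK _)) // ler_wpM2l.
Qed.

Lemma adjointD T T' S S' : adjoint T T' -> adjoint S S' ->
  adjoint (fun x => T x + S x) (fun x => T' x + S' x).
Proof. by move=> hT hS a b c; rewrite tDm hT hS. Qed.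

Lemma adjointZ k T T' : adjoint T T' ->
  adjoint (fun x => k *: T x) (fun x => k *: T' x).
Proof. by move=> hT a b c; rewrite tZm hT. Qed.

Lemma adjointN T T' : adjoint T T' ->
  adjoint (fun x => - T x) (fun x => - T' x).
Proof. by move=> hT a b c; rewrite tNm hT. Qed.

Lemma adjoint_comp T T' S S' : adjoint T T' -> adjoint S S' ->
  adjoint (fun x => T (S x)) (fun x => T' (S' x)).
Proof. by move=> hT hS a b c; rewrite hT hS. Qed.

Lemma selfadjoint_id : selfadjoint id.
Proof. by split; [exact: multiplier_id | move]. Qed.
Lemma selfadjointD T S : selfadjoint T -> selfadjoint S ->
  selfadjoint (fun x => T x + S x).
Proof. by move=> [? ?] [? ?]; split; [exact: multiplierD|exact: adjointD]. Qed.
Lemma selfadjointZ k T : selfadjoint T -> selfadjoint (fun x => k *: T x).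
Proof. by move=> [? ?]; split; [exact: multiplierZ|exact: adjointZ]. Qed.
Lemma selfadjointN T : selfadjoint T -> selfadjoint (fun x => - T x).
Proof. by move=> [? ?]; split; [exact: multiplierN|exact: adjointN]. Qed.
Lemma selfadjointB T S : selfadjoint T -> selfadjoint S ->
  selfadjoint (fun x => T x - S x).
Proof. by move=> hT /selfadjointN; exact: selfadjointD. Qed.
Lemma selfadjoint_comp T S : selfadjoint T -> selfadjoint S ->
  selfadjoint (fun x => T (S x)).
Proof.
by move=> [? ?] [? ?]; split; [exact: multiplier_comp|exact: adjoint_comp].
Qed.

Lemma multiplier_t e f : multiplier (t e f).
Proof.
split.
- by move=> k x y; rewrite tDr tZr.
- by move=> a b c; rewrite (t_outer ht).
- have [C C0 HC] := cj_bound hV; exists (C * N e * N f) => //.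
  by rewrite !mulr_ge0 ?norm_ge0.
Qed.

Lemma adjoint_t e f : adjoint (t e f) (t f e).
Proof. by move=> a b c; rewrite (t_middle ht). Qed.

Lemma selfadjoint_t e : selfadjoint (t e e).
Proof. by split; [exact: multiplier_t | exact: adjoint_t]. Qed.

Lemma multiplier_inv T Q (K : R) : multiplier T ->
  (forall x, T (Q x) = x) -> (forall x, Q (T x) = x) ->
  0 <= K -> (forall x, N (Q x) <= K * N x) -> multiplier Q.
Proof.
move=> hT TQ QT K0 HK; split; last by exists K.
- move=> k x y; rewrite -[RHS]QT; congr Q.
  by rewrite (mulD hT) (mulZ hT) !TQ.
- by move=> a b c; rewrite -[RHS]QT (mul_t hT) TQ.
Qed.

Lemma adjoint_inv T T' Q Q' : adjoint T T' ->
  (forall x, T (Q x) = x) -> (forall x, Q' (T' x) = x) -> adjoint Q Q'.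
Proof. by move=> hT TQ QT a b c; rewrite -{2}[b]TQ hT QT. Qed.

(** The inverse of [1 - T] for a contraction [T]. *)
Lemma multiplier_neumann T (q : R) : multiplier T -> 0 <= q < 1 ->
  (forall x, N (T x) <= q * N x) ->
  exists2 Q, multiplier Q &
    (forall x, Q x - T (Q x) = x) /\ (forall x, Q (x - T x) = x).
Proof.
move=> hT /[dup] q01 /andP[q0 q1] Tq.
have [Q HQ] := choice (cj_complete hV (mul_linear hT) q01 Tq).
have WQ x : Q x - T (Q x) = x by rewrite {1}HQ addrK.
have QW x : Q (x - T x) = x.
  apply/eqP; rewrite -subr_eq0; apply/eqP/(cj_norm_eq0 hV).
  set u := _ - x; have uE : u = T u.
    by rewrite /u (mulB hT) {1}HQ addrAC [x - _]addrC addrK addrC.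
  have := Tq u; rewrite -uE => uq; apply/le_anti.
  by rewrite norm_ge0 andbT; have := norm_ge0 u; nra.
exists Q => //; apply: (@multiplier_inv (fun x => x - T x) Q (1 - q)^-1) => //.
- by apply: multiplierD; [exact: multiplier_id|exact: multiplierN].
- by rewrite invr_ge0 subr_ge0 ltW.
- move=> x; rewrite ler_pdivlMl ?subr_gt0 //.
  have := Tq (Q x); have := cj_normD hV x (T (Q x)); rewrite -HQ; lra.
Qed.

(** * Unitary multipliers are contractions *)

(** Iterating the cube equation gives [f x ^ (3 ^ n) <= K * N x ^ (3 ^ n)], so the
    constant [K] disappears in the limit.  This replaces the spectral radius
    formula for self-adjoint operators. *)
Lemma norm_le_of_cube (f : V -> R) (K : R) :
  (forall x, 0 <= f x) -> (forall x, f x <= K * N x) ->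
  (forall x, f x ^+ 3 = f (t x x x)) -> forall x, f x <= N x.
Proof.
move=> f0 fK fcube x; apply: (@ler_of_pow_bounded _ _ _ K); first exact: norm_ge0.
move=> n; elim: n x => [|n IH] x; first by rewrite expn0 !expr1.
by rewrite expnS !exprM fcube -(cj_cube hV).
Qed.

(** The cube of [U x] is [U U' U], that is [U], applied to the cube of [x]. *)
Lemma unitary_contraction U U' : multiplier U -> adjoint U U' ->
  (forall x, U' (U x) = x) -> forall x, N (U x) <= N x.
Proof.
move=> hU hUU' U'U; have [K _ HK] := mul_bounded hU.
apply: (@norm_le_of_cube (fun x => N (U x)) K) => //.
  by move=> x; exact: norm_ge0.
move=> x; rewrite -(cj_cube hV) hUU' -(mul_t hU) -(mul_tr hU).
by rewrite U'U.
Qed.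

(** The real and the imaginary part of a unitary operator [A + i B].  The triple
    [V] has no multiplication by [i], so the two parts are kept apart. *)
Record unitary_pair (A B : V -> V) : Prop := UnitaryPair {
  up_l : selfadjoint A;
  up_r : selfadjoint B;
  up_sum : forall x, A (A x) + B (B x) = x }.

Lemma unitary_pairN A B : unitary_pair A B -> unitary_pair A (fun x => - B x).
Proof.
move=> [hA hB AB]; split=> //; first exact: selfadjointN.
by move=> x; rewrite (mulN hB.1) opprK.
Qed.

(** The cube of [A x + i B x] is [A + i B] applied to [A ^ 2 + B ^ 2] applied to
    the cube of [x], which is [A + i B] applied to the cube of [x]. *)
Lemma unitary_pair_complex_le A B : unitary_pair A B ->
  forall x, N2 (A x) (B x) <= N x.
Proof.
move=> [[hA hA'] [hB hB'] AB].
have [K K0 HK] := mul_bounded hA; have [L L0 HL] := mul_bounded hB.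
apply: (@norm_le_of_cube (fun x => N2 (A x) (B x)) (K + L)) => [x|x|x].
- exact: (cj_complex_ge0 hV).
- by rewrite (le_trans (cj_complex_le hV _ _)) // mulrDl lerD.
rewrite (cj_complex_cube hV); congr N2.
- rewrite !hA' !hB' -!(mul_t hA) -!(mul_t hB) -!(mul_tr hA) -!(mul_tr hB).
  rewrite (multiplier_comm (B (t x x x)) hB hA) mulr2n addrA addrK -(mulD hA).
  by rewrite AB.
- rewrite !hA' !hB' -!(mul_t hA) -!(mul_t hB) -!(mul_tr hA) -!(mul_tr hB).
  rewrite (multiplier_comm (t x x x) hA hB) (multiplier_comm _ hA hB).
  by rewrite mulr2n addrK -(mulD hB) AB.
Qed.

(** Both [A + i B] and [A - i B] are contractions, and [A x] and [i B x] are half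
    their sum and half their difference. *)
Lemma unitary_pair_contraction A B : unitary_pair A B ->
  forall x, N (A x) <= N x /\ N (B x) <= N x.
Proof.
move=> hAB x; have h1 := unitary_pair_complex_le hAB x.
have h2 := unitary_pair_complex_le (unitary_pairN hAB) x.
have := cj_complexl hV (A x) (B x); have := cj_complexr hV (A x) (B x).
by rewrite !mulr2n => ? ?; split; lra.
Qed.

Lemma unitary_pair_id : unitary_pair id (fun=> 0).
Proof.
split; [exact: selfadjoint_id| |by move=> x; rewrite addr0].
have := selfadjointZ 0 selfadjoint_id; congr selfadjoint.
by apply/funext => x; rewrite scale0r.
Qed.

Lemma unitary_pair_comp A B A' B' : unitary_pair A B -> unitary_pair A' B' ->
  unitary_pair (fun x => A (A' x) - B (B' x)) (fun x => A (B' x) + B (A' x)).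
Proof.
move=> [hA hB AB] [hA' hB' AB']; split.
- by apply: selfadjointB; exact: selfadjoint_comp.
- by apply: selfadjointD; exact: selfadjoint_comp.
move=> x; set p := A' x; set q := B' x; set u := A p - B q; set v := A q + B p.
have uE : A u + B v = p.
  rewrite /u /v (mulB hA.1) (mulD hB.1) (multiplier_comm q hA.1 hB.1).
  by rewrite addrA subrK AB.
have vE : A v - B u = q.
  rewrite /u /v (mulD hA.1) (mulB hB.1) (multiplier_comm p hA.1 hB.1).
  by rewrite opprB addrACA subrr addr0 AB.
rewrite (multiplier_comm u hA.1 hA'.1) (multiplier_comm u hB.1 hB'.1).
rewrite (multiplier_comm v hA.1 hB'.1) (multiplier_comm v hB.1 hA'.1).
rewrite [B' (A v) + _]addrC addrACA -(mulD hA'.1) uE.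
by rewrite [- _ + _]addrC -(mulB hB'.1) vE AB'.
Qed.

(** * Resolvents of self-adjoint multipliers *)

(** The operator [P] is the inverse of [r ^ 2 + H ^ 2], a real substitute for the
    two complex resolvents of [H] at [i r] and [- i r]. *)
Definition resolvent (H : V -> V) (r : R) (P : V -> V) :=
  selfadjoint P /\ forall x, r ^+ 2 *: P x + H (H (P x)) = x.

Section Cayley.
Variables (H P : V -> V) (r : R).
Hypotheses (hH : selfadjoint H) (hP : resolvent H r P).

Lemma resolventK x : P (r ^+ 2 *: x + H (H x)) = x.
Proof.
rewrite (mulD hP.1.1) (mulZ hP.1.1) !(multiplier_comm _ hP.1.1 hH.1).
exact: hP.2.
Qed.

(** The Cayley transform [(H + i r) / (H - i r)] is
    [(H ^ 2 - r ^ 2) P + 2 i r H P], and [H ^ 2 P = 1 - r ^ 2 P]. *)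
Definition cayley_re x := x - (2 * r ^+ 2) *: P x.
Definition cayley_im x := (2 * r) *: H (P x).

Lemma cayley_unitary : unitary_pair cayley_re cayley_im.
Proof.
have [sP Pr] := hP; split.
- by apply: selfadjointB; [exact: selfadjoint_id|exact: selfadjointZ].
- by apply: selfadjointZ; exact: selfadjoint_comp.
move=> x; rewrite /cayley_re /cayley_im.
rewrite (mulZ sP.1) (mulZ hH.1) (mulB sP.1) (mulZ sP.1) !scalerA.
have -> : H (P (H (P x))) = P x - r ^+ 2 *: P (P x).
  rewrite -[H (P (H _))](multiplier_comm _ sP.1 hH.1) -[H (H (P x))](addKr (r ^+ 2 *: P x)).
  by rewrite Pr (mulD sP.1) (mulN sP.1) (mulZ sP.1) addrC.
rewrite !scalerBr !scalerA -[RHS]addr0 -!addrA; congr (x + _).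
have -> : 2 * r * (2 * r) = 2 * r ^+ 2 + 2 * r ^+ 2 by ring.
have : (2 * r ^+ 2 + 2 * r ^+ 2) * r ^+ 2 = 2 * r ^+ 2 * (2 * r ^+ 2) by ring.
move: (2 * r ^+ 2) => k ->; rewrite scalerDl opprB.
by rewrite [_ *: P (P x) - _ + _]addrC subrKA addrK addNr.
Qed.

(** [r ^ 2 P] is [(1 - A) / 2] for the real part [A] of the Cayley transform. *)
Lemma resolvent_norm x : N (r ^+ 2 *: P x) <= N x.
Proof.
have [h1 _] := unitary_pair_contraction cayley_unitary x.
have -> : r ^+ 2 *: P x = 2^-1 *: (x - cayley_re x).
  by rewrite /cayley_re opprB addrC subrK scalerA mulrA mulVf ?mul1r ?pnatr_eq0.
rewrite (cj_normZ hV) ger0_norm ?invr_ge0 //.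
by have := normB x (cayley_re x); lra.
Qed.

Lemma resolvent_im_norm x : 0 <= r -> N (H (r ^+ 2 *: P x)) <= r * N x.
Proof.
move=> r0; have [_ h1] := unitary_pair_contraction cayley_unitary x.
have -> : H (r ^+ 2 *: P x) = (r / 2) *: cayley_im x.
  by rewrite /cayley_im (mulZ hH.1) scalerA; congr (_ *: _); field.
rewrite (cj_normZ hV) ger0_norm ?divr_ge0 //.
have := norm_ge0 x; nra.
Qed.

End Cayley.

(** For large [r] the operator [H ^ 2 / r ^ 2] is a contraction. *)
Lemma resolvent_large H : selfadjoint H ->
  exists r P, 0 < r /\ resolvent H r P.
Proof.
move=> hH; have hH2 := selfadjoint_comp hH hH.
have [K K0 HK] := mul_bounded hH2.1.
pose r := Num.sqrt (2 * (K + 1)).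
have r2 : r ^+ 2 = 2 * (K + 1) by rewrite sqr_sqrtr //; lra.
have r0 : 0 < r by rewrite sqrtr_gt0; lra.
pose T x := - (r ^+ 2)^-1 *: H (H x).
have hT : selfadjoint T by exact: selfadjointZ.
have TN x : N (T x) <= 2^-1 * N x.
  rewrite /T (cj_normZ hV) normrN gtr0_norm ?invr_gt0 ?exprn_gt0 // r2.
  rewrite ler_pdivrMl; last by lra.
  apply: le_trans (HK x) _; have := norm_ge0 x; nra.
have [|Q hQ [WQ QW]] := multiplier_neumann hT.1 _ TN; first by lra.
have aQ : adjoint Q Q.
  apply: (@adjoint_inv (fun x => x - T x) (fun x => x - T x)) => //.
  by apply: adjointD; [move|apply: adjointN; case: hT].
exists r, (fun x => (r ^+ 2)^-1 *: Q x); split=> //; split.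
  exact: selfadjointZ.
move=> x; rewrite scalerA divff ?lt0r_neq0 ?exprn_gt0 // scale1r.
rewrite !(mulZ hH.1) -[RHS]WQ /T; congr (_ + _).
by rewrite scaleNr opprK.
Qed.

(** The operator [r ^ 2 / 4 + H ^ 2] factors as [r ^ 2 + H ^ 2] times
    [1 - 3 / 4 (r ^ 2 P)], and [r ^ 2 P] is a contraction.  The a priori bound on
    the resolvent thus lets [r] go down to zero, which shows that the spectrum
    of [H] is real without any holomorphic functional calculus. *)
Lemma resolvent_half H r P : selfadjoint H -> 0 < r -> resolvent H r P ->
  exists P', resolvent H (r / 2) P'.
Proof.
move=> hH r0 hP.
pose T x := (3 / 4 : R) *: (r ^+ 2 *: P x).
have hT : selfadjoint T by do 2 apply: selfadjointZ; exact: hP.1.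
have TN x : N (T x) <= 3 / 4 * N x.
  rewrite /T (cj_normZ hV) ger0_norm; last by lra.
  by rewrite ler_wpM2l ?(resolvent_norm hH hP) //; lra.
have [|Q hQ [WQ QW]] := multiplier_neumann hT.1 _ TN; first by lra.
have aQ : adjoint Q Q.
  apply: (@adjoint_inv (fun x => x - T x) (fun x => x - T x)) => //.
  by apply: adjointD; [move|apply: adjointN; case: hT].
exists (fun x => P (Q x)); split; first by apply: selfadjoint_comp => //; exact: hP.1.
move=> x; rewrite -[RHS]WQ /T; set y := Q x.
rewrite -{3}(hP.2 y) scalerA addrAC -scalerBl; congr (_ *: _ + _).
by field.
Qed.

Lemma resolvent_small H e : selfadjoint H -> 0 < e ->
  exists r P, 0 < r <= e /\ resolvent H r P.
Proof.
move=> hH e0; have [r [P [r0 hP]]] := resolvent_large hH.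
have hn n : exists P', resolvent H (r / 2 ^+ n) P'.
  elim: n => [|n [P' hP']]; first by rewrite expr0 divr1; exists P.
  have [|P'' hP''] := resolvent_half hH _ hP'; first by rewrite divr_gt0 ?exprn_gt0.
  by exists P''; rewrite exprSr invfM mulrA.
have re : 0 <= r / e by rewrite divr_ge0 ?ltW.
have := archi_boundP re; set n := Num.bound _ => Hn.
have [P' hP'] := hn n; exists (r / 2 ^+ n), P'; split=> //.
rewrite divr_gt0 ?exprn_gt0 //= ler_pdivrMr ?exprn_gt0 // mulrC -ler_pdivrMr //.
by rewrite (le_trans (ltW Hn)) // -natrX ler_nat ltnW // ltn_expl.
Qed.

(** * The norm of a sum of nearly orthogonal elements *)

Definition small_product (eta : R) (f g : V) :=
  [/\ N f <= 1, N g <= 1, forall y, N (t f g y) <= eta * N y &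
      forall y, N (t g f y) <= eta * N y].

(** Every factor on the right pairs [f] with [g], so it is small when the
    products of [f] and [g] are. *)
Lemma t_cubes f g y :
  t (t f f f) (t g g g) y = t f g (t g f (t f g y)).
Proof.
by rewrite (t_outer ht) (t_middle ht) (t_swap ht).
Qed.

Lemma small_product_cube eta f g : 0 <= eta <= 1 -> small_product eta f g ->
  small_product eta (t f f f) (t g g g).
Proof.
move=> /andP[e0 e1] [f1 g1 fg gf]; split.
- by rewrite (cj_cube hV) exprn_ile1 ?norm_ge0.
- by rewrite (cj_cube hV) exprn_ile1 ?norm_ge0.
- move=> y; rewrite t_cubes (le_trans (fg _)) // ler_wpM2l //.
  have := gf (t f g y); have := fg y.
  by have := norm_ge0 y; have := norm_ge0 (t f g y); nra.
- move=> y; rewrite t_cubes (le_trans (gf _)) // ler_wpM2l //.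
  have := fg (t g f y); have := gf y.
  by have := norm_ge0 y; have := norm_ge0 (t g f y); nra.
Qed.

(** The six mixed terms in the expansion of the cube have norm at most [eta]. *)
Lemma norm_cubeD eta f g : 0 <= eta <= 1 -> small_product eta f g ->
  N (f + g) ^+ 3 <= N (t f f f + t g g g) + 6 * eta.
Proof.
move=> /andP[e0 e1] [f1 g1 fg gf].
have le_eta a b c : (forall y, N (t a b y) <= eta * N y) -> N c <= 1 ->
  N (t a b c) <= eta.
  by move=> ab c1; rewrite (le_trans (ab c)) // ler_piMr.
have -> : N (f + g) ^+ 3 = N (t f f f + t g g g
    + (t g f f + t f g f + t g f f) + (t f g g + t g f g + t f g g)).
  rewrite -(cj_cube hV) !(tDl, tDm, tDr) (ct_sym ht f f g) (ct_sym ht g g f).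
  by rewrite (AC ((2*2)*(2*2)) ((1*8*(2*3*5))*(4*6*7)))/=.
have ? := le_eta g f f gf f1; have ? := le_eta f g f fg f1.
have ? := le_eta f g g fg g1; have ? := le_eta g f g gf g1.
have le_add3 a b c : N a <= eta -> N b <= eta -> N c <= eta ->
  N (a + b + c) <= 3 * eta.
  have := cj_normD hV (a + b) c; have := cj_normD hV a b; lra.
set u := t f f f + t g g g; set p := t g f f + _ + _; set q := t f g g + _ + _.
have := cj_normD hV (u + p) q; have := cj_normD hV u p.
have : N p <= 3 * eta by exact: le_add3.
by have : N q <= 3 * eta by [exact: le_add3]; lra.
Qed.

(** Cubing keeps products small, so a bound [u] valid for all such pairs
    improves to the cube root of [u + 6 eta]; the distance to [1 + 3 eta] is
    halved each time, starting from the triangle inequality. *)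
Lemma small_product_norm eta f g : 0 <= eta <= 1 -> small_product eta f g ->
  N (f + g) <= 1 + 3 * eta.
Proof.
move=> /[dup] e01 /andP[e0 e1] fg; apply: ler_of_halving => n.
elim: n f g fg => [|n IH] f g fg.
  have [f1 g1 _ _] := fg; have := cj_normD hV f g; rewrite expr0; lra.
have := norm_cubeD e01 fg; have := IH _ _ (small_product_cube e01 fg).
rewrite (exprS 2^-1); have : 0 <= 2^-1 ^+ n :> R by rewrite exprn_ge0 ?invr_ge0.
move: (2^-1 ^+ n) => d d0; set w := N _; set z := N _ => wd zw.
rewrite leNgt; apply/negP => dz; have z3 : z ^+ 3 <= 1 + 3 * eta + d + 6 * eta by lra.
(* Bernoulli's inequality *)
have : 1 + 3 * (z - 1) <= z ^+ 3.
  have z1 : 0 <= z - 1 by lra.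
  have zE : 1 + (z - 1) = z by rewrite addrC subrK.
  rewrite -[in X in _ <= X]zE.
  move: (z - 1) z1 => y y0.
  have : 0 <= y ^+ 2 by exact: exprn_ge0. have : 0 <= y ^+ 3 by exact: exprn_ge0.
  have -> : (1 + y) ^+ 3 = 1 + 3 * y + 3 * y ^+ 2 + y ^+ 3 by ring.
  lra.
lra.
Qed.

(** * Derivation forms are local *)

Record derivation_form (beta : V -> V -> R) : Prop := DerivationForm {
  df_linl : forall x, linear (fun a => beta a x : R^o);
  df_linr : forall a, linear (beta a : V -> R^o);
  df_leibniz : forall a b c x,
    beta (t a b c) x = beta a (t b c x) + beta b (t a x c) + beta c (t b a x);
  df_bounded : exists2 M : R, 0 <= M & forall a x, `|beta a x| <= M * N a * N x }.

Variable beta : V -> V -> R.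
Hypothesis hb : derivation_form beta.

Lemma betaDl a b x : beta (a + b) x = beta a x + beta b x.
Proof. by have := df_linl hb x 1 a b; rewrite !scale1r. Qed.
Lemma betaDr a x y : beta a (x + y) = beta a x + beta a y.
Proof. by have := df_linr hb a 1 x y; rewrite !scale1r. Qed.
Lemma beta0l x : beta 0 x = 0.
Proof. by have := betaDl 0 0 x; rewrite addr0; lra. Qed.
Lemma beta0r a : beta a 0 = 0.
Proof. by have := betaDr a 0 0; rewrite addr0; lra. Qed.
Lemma betaZl k a x : beta (k *: a) x = k * beta a x.
Proof. by have := df_linl hb x k a 0; rewrite !addr0 beta0l addr0. Qed.
Lemma betaZr k a x : beta a (k *: x) = k * beta a x.
Proof. by have := df_linr hb a k x 0; rewrite !addr0 beta0r addr0. Qed.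
Lemma betaNl a x : beta (- a) x = - beta a x.
Proof. by rewrite -scaleN1r betaZl mulN1r. Qed.
Lemma betaNr a x : beta a (- x) = - beta a x.
Proof. by rewrite -scaleN1r betaZr mulN1r. Qed.
Definition betaE := (betaDl, betaDr, betaNl, betaNr, betaZl, betaZr).

(** Locality says that this vanishes.  For a skew combination of the operators
    [t e f] it is the derivative of [beta] along the unitary group generated. *)
Definition defect e f a x := beta (t e f a) x - beta a (t f e x).

(** The Leibniz rule rewrites the defect by terms that depend on [a] and [x]
    through [t f a x] and [t e x a] only, whence its own invariance below. *)
Lemma defectE e f a x : defect e f a x = beta e (t f a x) + beta f (t e x a).
Proof. by rewrite /defect (df_leibniz hb) addrK. Qed.

Lemma defect_adjoint e f T T' a x : multiplier T -> multiplier T' ->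
  adjoint T T' -> adjoint T' T -> defect e f (T a) x = defect e f a (T' x).
Proof.
move=> hT hT' TT' T'T; rewrite !defectE; congr (beta _ _ + beta _ _).
  by rewrite TT' (mul_tr hT').
by rewrite T'T (mul_tr hT).
Qed.

Lemma defectDl e f a b x : defect e f (a + b) x = defect e f a x + defect e f b x.
Proof. rewrite /defect tDr // !betaE; lra. Qed.
Lemma defectDr e f a x y : defect e f a (x + y) = defect e f a x + defect e f a y.
Proof. rewrite /defect tDr // !betaE; lra. Qed.
Lemma defectZl e f k a x : defect e f (k *: a) x = k * defect e f a x.
Proof. by rewrite /defect tZr // !betaE mulrBr. Qed.
Lemma defectZr e f k a x : defect e f a (k *: x) = k * defect e f a x.
Proof. by rewrite /defect tZr // !betaE mulrBr. Qed.

(** The pair [U = A + i B] is the Cayley transform of [H = t e e].  Conjugating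
    [beta] by [U] changes it by [i] times a multiple of [C (P a) x], a form
    invariant under [U].  The powers of [U] are contractions, so this form
    vanishes. *)
Section Symmetric.
Variables (e : V) (r : R) (P : V -> V).
Hypotheses (r0 : 0 < r) (hP : resolvent (t e e) r P).
Let H := t e e.
Let hH : selfadjoint H := selfadjoint_t e.
Let A := cayley_re P r.
Let B := cayley_im H P r.
Let C a x := defect e e a x.

Let cH a x : beta (H a) x = beta a (H x) + C a x.
Proof. by rewrite /C /defect addrC subrK. Qed.

Let C_adj T a x : selfadjoint T -> C (T a) x = C a (T x).
Proof. by move=> [hT TT]; exact: defect_adjoint. Qed.

Let C_Dl a b x : C (a + b) x = C a x + C b x.
Proof. exact: defectDl. Qed.
Let C_Dr a x y : C a (x + y) = C a x + C a y.
Proof. exact: defectDr. Qed.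
Let C_Zl k a x : C (k *: a) x = k * C a x.
Proof. exact: defectZl. Qed.
Let C_Zr k a x : C a (k *: x) = k * C a x.
Proof. exact: defectZr. Qed.

Let AE x : A x = H (H (P x)) - r ^+ 2 *: P x.
Proof.
rewrite /A /cayley_re -{1}(hP.2 x) [_ + H _]addrC mulrDl mul1r scalerDl opprD.
by rewrite addrA addrK.
Qed.

Let BE x : B x = (2 * r) *: H (P x).
Proof. by []. Qed.

Let xE x : x = r ^+ 2 *: P x + H (H (P x)).
Proof. by rewrite hP.2. Qed.

Lemma cayley_beta_re a x : beta (A a) (A x) + beta (B a) (B x) = beta a x.
Proof.
rewrite [in RHS](xE a) [in RHS](xE x) !AE !BE.
move: (P a) (P x) => {}a {}x; rewrite !betaE !cH !(C_adj _ _ hH).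
by ring.
Qed.

Lemma cayley_beta_im a x :
  beta (B a) (A x) - beta (A a) (B x) = - (2 * r) * C (P a) x.
Proof.
rewrite [in RHS](xE x) !AE !BE.
move: (P a) (P x) => {}a {}x; rewrite C_Dr C_Zr.
rewrite !betaE !cH !(C_adj _ _ hH).
by ring.
Qed.

Lemma defect_symmetric_resolvent a x : C (P a) x = 0.
Proof.
have hAB : unitary_pair A B by exact: cayley_unitary.
have hP1 : selfadjoint P := hP.1.
(* A pair [z] stands for [z.1 + i z.2], and [f] is minus the imaginary part of
   the complex extension of [beta], conjugate linear in its first argument. *)
pose X := ((V * V) * (V * V))%type.
pose rot (z : V * V) := (A z.1 - B z.2, B z.1 + A z.2).
pose U (z : X) : X := (rot z.1, rot z.2).
pose f (z : X) := beta z.1.2 z.2.1 - beta z.1.1 z.2.2.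
pose k (z : X) := - (2 * r) * (C (P z.1.1) z.2.1 + C (P z.1.2) z.2.2).
have fU z : f (U z) = f z + k z.
  case: z => [[a1 a2] [x1 x2]]; rewrite /f /k /= mulrDr -!cayley_beta_im.
  rewrite -(cayley_beta_re a2 x1) -(cayley_beta_re a1 x2) !betaE.
  by ring.
have CU A' B' a1 a2 x1 x2 : unitary_pair A' B' ->
    C (P (A' a1 - B' a2)) (A' x1 - B' x2) + C (P (B' a1 + A' a2)) (B' x1 + A' x2)
    = C (P a1) x1 + C (P a2) x2.
  move=> [hA hB AB].
  have moveT T y z : selfadjoint T -> C (P (T y)) z = C (P y) (T z).
    by move=> hT; rewrite (multiplier_comm _ hP1.1 hT.1) C_adj.
  have CN y z : C y (- z) = - C y z by rewrite -scaleN1r C_Zr mulN1r.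
  have CN' y z : C (- y) z = - C y z by rewrite -scaleN1r C_Zl mulN1r.
  rewrite !(mulD hP1.1, mulN hP1.1, C_Dl, C_Dr, CN, CN').
  rewrite !(fun y z => moveT A' y z hA) !(fun y z => moveT B' y z hB).
  rewrite -[in RHS](AB x1) -[in RHS](AB x2) !C_Dr !(multiplier_comm _ hA.1 hB.1).
  by ring.
have kU z : k (U z) = k z.
  by case: z => [[a1 a2] [x1 x2]]; rewrite /k /= CU.
have [M M0 HM] := df_bounded hb.
have orbit n : exists A' B', unitary_pair A' B' /\
    forall y, iter n rot (y, 0) = (A' y, B' y).
  elim: n => [|n [A' [B' [hA'B' IH]]]].
    by exists id, (fun=> 0); split=> //; exact: unitary_pair_id.
  exists (fun y => A (A' y) - B (B' y)), (fun y => A (B' y) + B (A' y)); split.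
    exact: unitary_pair_comp.
  by move=> y; rewrite iterS IH /rot /= [B _ + _]addrC.
have iterU n z : iter n U z = (iter n rot z.1, iter n rot z.2).
  by elim: n => [|n IH] /=; [case: z | rewrite IH].
have fM n : `|f (iter n U ((a, 0), (x, 0)))| <= 2 * (M * N a * N x).
  have [A' [B' [hA'B' HAB]]] := orbit n; rewrite iterU !HAB /f /=.
  have [Aa Ba] := unitary_pair_contraction hA'B' a.
  have [Ax Bx] := unitary_pair_contraction hA'B' x.
  have bd y z : N y <= N a -> N z <= N x -> `|beta y z| <= M * N a * N x.
    move=> ya zx; rewrite (le_trans (HM _ _)) // -!mulrA ler_wpM2l //.
    by rewrite ler_pM ?norm_ge0.
  rewrite mulr2n mulrDl mul1r (le_trans (ler_normB _ _)) // lerD //; exact: bd.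
have C0 y : C y 0 = 0 by have := C_Zr 0 y 0; rewrite scale0r mul0r.
have := winding_eq0 fU kU fM; rewrite /k /= C0 addr0 => /eqP.
by rewrite mulf_eq0 oppr_eq0 mulf_eq0 pnatr_eq0 /= gt_eqF //= => /eqP.
Qed.

End Symmetric.

Lemma defect_symmetric e a x : defect e e a x = 0.
Proof.
have [r [P [/andP[r0 _] hP]]] := resolvent_small (selfadjoint_t e) (@ltr01 R).
rewrite -(resolventK (selfadjoint_t e) hP a).
exact: (defect_symmetric_resolvent r0 hP).
Qed.

Lemma defect_antisym e f a x : defect e f a x = - defect f e a x.
Proof.
have := defect_symmetric (e + f) a x; have := defect_symmetric e a x.
have := defect_symmetric f a x; rewrite /defect !(tDl, tDm) // !betaE; lra.
Qed.

(** Over the reals the symmetric operators do not determine the others, since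
    [e] cannot be replaced by [i e].  The difference of [t e f] and [t f e] is
    skew, so its Cayley transform [(1 + J) / (1 - J)] is a unitary operator of
    [V] itself and the winding argument applies once more. *)
Section Skew.
Variables (e f : V) (r : R) (Q Q' : V -> V).
Hypothesis r0 : 0 < r.
Let J x := r *: (t e f x - t f e x).
Hypotheses (hQ : multiplier Q) (hQ' : multiplier Q').
Hypotheses (WQ : forall x, Q x - J (Q x) = x) (QW : forall x, Q (x - J x) = x).
Hypotheses (WQ' : forall x, Q' x + J (Q' x) = x) (QW' : forall x, Q' (x + J x) = x).

Let hJ : multiplier J.
Proof.
apply: multiplierZ; apply: multiplierD; first exact: multiplier_t.
by apply: multiplierN; exact: multiplier_t.
Qed.

Let adjJ : adjoint J (fun x => - J x).
Proof.
move=> a b c; rewrite /J tZm // tDm // tNm // -scalerN opprB.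
by rewrite !(t_middle ht).
Qed.

Let U x := Q x + J (Q x).
Let U' x := Q' x - J (Q' x).

Let hU : multiplier U.
Proof. by apply: multiplierD => //; exact: multiplier_comp. Qed.

Let hU' : multiplier U'.
Proof. by apply: multiplierD => //; apply: multiplierN; exact: multiplier_comp. Qed.

Let UK x : U' (U x) = x.
Proof. by rewrite /U' /U QW' WQ. Qed.

Let adjQ : adjoint Q Q'.
Proof.
apply: (@adjoint_inv (fun x => x - J x) (fun x => x + J x)) => // a b c.
by rewrite tDm // tNm // adjJ opprK.
Qed.

Let adjQ' : adjoint Q' Q.
Proof.
apply: (@adjoint_inv (fun x => x + J x) (fun x => x - J x)) => // a b c.
by rewrite tDm // adjJ.
Qed.

Let adjU : adjoint U U'.
Proof. by move=> a b c; rewrite /U tDm // adjJ adjQ. Qed.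

Let adjU' : adjoint U' U.
Proof. by move=> a b c; rewrite /U' tDm // tNm // adjJ adjQ' opprK. Qed.

Let defJ a x : beta (J a) x + beta a (J x) = 2 * r * defect e f a x.
Proof.
have := defect_antisym e f a x; rewrite /J /defect !betaE => E.
have -> : 2 * r * (beta (t e f a) x - beta a (t f e x))
  = r * ((beta (t e f a) x - beta a (t f e x)) + (beta (t e f a) x - beta a (t f e x))) by ring.
rewrite {2}E; ring.
Qed.

Lemma defect_skew_resolvent a x : defect e f (Q a) (Q x) = 0.
Proof.
pose k (z : V * V) := 4 * r * defect e f (Q z.1) (Q z.2).
pose g (z : V * V) := beta z.1 z.2.
pose W (z : V * V) := (U z.1, U z.2).
have gW z : g (W z) = g z + k z.
  case: z => y z; rewrite /g /k /= -[in X in beta y X](WQ z) -[in X in beta X _ + _](WQ y).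
  rewrite /U; move: (Q y) (Q z) => {}y {}z.
  have -> : 4 * r * defect e f y z = 2 * (2 * r * defect e f y z) by ring.
  by rewrite -defJ; move: (J y) (J z) => u v; rewrite !betaE; ring.
have kW z : k (W z) = k z.
  case: z => y z; rewrite /k /=; congr (_ * _).
  rewrite (multiplier_comm y hQ hU) (multiplier_comm z hQ hU).
  by rewrite (defect_adjoint _ _ _ _ hU hU' adjU adjU') UK.
have [M M0 HM] := df_bounded hb.
have UN n y : N (iter n U y) <= N y.
  elim: n => //= n IH; apply: le_trans IH.
  exact: (unitary_contraction hU adjU UK).
have iterW n z : iter n W z = (iter n U z.1, iter n U z.2).
  by elim: n => [|n IH] /=; [case: z | rewrite IH].
have gM n : `|g (iter n W (a, x))| <= M * N a * N x.
  rewrite iterW /g /= (le_trans (HM _ _)) // -!mulrA ler_wpM2l //.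
  by rewrite ler_pM ?norm_ge0.
have := winding_eq0 gW kW gM; rewrite /k /= => /eqP.
by rewrite mulf_eq0 mulf_eq0 pnatr_eq0 /= gt_eqF //= => /eqP.
Qed.

End Skew.

Lemma defect_eq0 e f a x : defect e f a x = 0.
Proof.
pose J0 x := t e f x - t f e x.
have hJ0 : multiplier J0.
  apply: multiplierD; first exact: multiplier_t.
  by apply: multiplierN; exact: multiplier_t.
have [K K0 HK] := mul_bounded hJ0.
pose r := (2 * (K + 1))^-1.
have r0 : 0 < r by rewrite invr_gt0; lra.
pose J x := r *: J0 x.
have hJ : multiplier J by exact: multiplierZ.
have JN y : N (J y) <= 2^-1 * N y.
  rewrite /J (cj_normZ hV) gtr0_norm // /r invfM -mulrA ler_wpM2l ?invr_ge0 //.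
  rewrite ler_pdivrMl; last by lra.
  by apply: le_trans (HK y) _; have := norm_ge0 y; nra.
have JN' y : N (- J y) <= 2^-1 * N y by rewrite normN.
have half : 0 <= (2^-1 : R) < 1 by apply/andP; split; lra.
have [Q hQ [WQ QW]] := multiplier_neumann hJ half JN.
have [Q' hQ' [WQ' QW']] := multiplier_neumann (multiplierN hJ) half JN'.
rewrite -(QW a) -(QW x).
apply: (@defect_skew_resolvent e f r Q Q') => // y.
  by rewrite -[RHS]WQ' opprK.
by rewrite -[RHS]QW' opprK.
Qed.

(** * Approximation by inner forms *)

Lemma beta_adj e f a x : beta (t e f a) x = beta a (t f e x).
Proof. by have /eqP := defect_eq0 e f a x; rewrite subr_eq0 => /eqP. Qed.

Lemma beta_skew e f a x : beta e (t f a x) = - beta f (t e x a).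
Proof.
by have /eqP := defect_eq0 e f a x; rewrite defectE addr_eq0 => /eqP.
Qed.

Definition inner_form (b e a x : V) := beta e (t b x a) - beta e (t b a x).

Lemma inner_formE b e a x :
  inner_form b e a x = - beta a (t e b x) - beta a (t b e x).
Proof.
rewrite /inner_form (beta_skew e b) (ct_sym ht e a x) -beta_adj.
rewrite (ct_sym ht a x b) beta_adj (ct_sym ht x b e).
rewrite (ct_sym ht b a x) -(beta_adj a x e).
by rewrite (ct_sym ht a x e) beta_adj (ct_sym ht x e b).
Qed.

(** Locality moves everything onto [x]: an inner form is [beta] with [x]
    multiplied by an operator, here by [G] times [t b b]. *)
Lemma inner_form_multiplier b G a x : selfadjoint G ->
  inner_form (- 2^-1 *: b) (G b) a x = beta a (G (t b b x)).
Proof.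
move=> [hG GG]; rewrite inner_formE tZl // tZm // GG -(mul_t hG) !betaZr.
by field.
Qed.

(** The operator [w = r ^ 2 / (r ^ 2 + H ^ 2)] with [H = t a a] is close to one
    where [a] is close to zero and small elsewhere.  Therefore [w a] is small,
    the cube of its norm being at most the norm of [H (w a)], and [1 - w ^ 2] is
    a multiple of [H]. *)
Lemma cutoff a xi : 0 < xi -> exists w G, [/\ selfadjoint w, selfadjoint G,
  forall x, N (w x) <= N x, forall y x, beta (w y) x = beta y (w x) &
  N (w a) <= xi /\ forall x, x - w (w x) = G (t a a x)].
Proof.
move=> xi0; pose H := t a a; have hH : selfadjoint H := selfadjoint_t a.
have e0 : 0 < xi ^+ 3 / (N a + 1).
  by rewrite divr_gt0 ?exprn_gt0 // ltr_wpDl ?norm_ge0.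
have [r [P [/andP[r0 re] hP]]] := resolvent_small hH e0.
pose w x := r ^+ 2 *: P x; have hw : selfadjoint w by apply: selfadjointZ; exact: hP.1.
have wN x : N (w x) <= N x by exact: (resolvent_norm hH hP).
exists w, (fun x => H (P (x + w x))); split=> //.
- apply: (@selfadjoint_comp H) => //; apply: (@selfadjoint_comp P); first exact: hP.1.
  exact: (selfadjointD selfadjoint_id hw).
- move=> y x; rewrite /w betaZl betaZr; congr (_ * _).
  by rewrite -{2}(hP.2 y) -{1}(hP.2 x) !betaE /H !beta_adj.
split.
  rewrite -(ler_pXn2r (isT : (0 < 3)%N)) ?nnegrE ?norm_ge0 ?(ltW xi0) //.
  have [sw ww] := hw.
  rewrite -(cj_cube hV) ww -(mul_t sw) -(mul_tr sw) (le_trans (wN _)) //.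
  rewrite (le_trans (wN _)) // (multiplier_comm a sw hH.1).
  rewrite (le_trans (resolvent_im_norm hH hP a (ltW r0))) //.
  move: re; rewrite ler_pdivlMr ?ltr_wpDl ?norm_ge0 // => re.
  by apply: le_trans re; rewrite ler_wpM2l ?(ltW r0) // lerDl.
move=> x; rewrite -/(H x) (multiplier_comm x hw.1 hH.1) -(mulD hH.1).
rewrite (multiplier_comm _ hP.1.1 hH.1).
have /(canRL (addKr _)) -> := hP.2 (x + w x).
by rewrite -/(w _) (mulD hw.1) [RHS]addrC opprD addrA addrK.
Qed.

(** The elements [a0] and [w a] are nearly orthogonal because [w a0] is small. *)
Lemma norm_perturbation eta a0 a w : selfadjoint w ->
  (forall x, N (w x) <= N x) -> 0 <= eta <= 1 -> N a0 <= 1 -> N a <= 1 ->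
  (forall x, N (t (w a0) a x) <= eta * N x) ->
  (forall x, N (t a (w a0) x) <= eta * N x) ->
  N (a0 + w a) <= 1 + 3 * eta.
Proof.
move=> [hw ww] wN e01 a01 a1 h1 h2; apply: small_product_norm => //; split=> //.
- by rewrite (le_trans (wN _)).
- by move=> y; rewrite ww (mul_t hw).
- by move=> y; rewrite -(mul_t hw) -ww.
Qed.

Lemma beta_sup : exists2 m : R, 0 <= m &
  (forall a x, beta a x <= m * N a * N x) /\
  forall d, 0 < d -> exists a x, [/\ N a <= 1, N x <= 1 & m - d <= beta a x].
Proof.
pose S := [set beta p.1 p.2 | p in [set p | N p.1 <= 1 /\ N p.2 <= 1]]%classic.
have [M M0 HM] := df_bounded hb.
have S0 : S 0.
  by exists (0, 0) => /=; rewrite ?beta0l // norm0.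
have hS : has_sup S.
  split; first by exists 0.
  exists M => _ [[a x] /= [a1 x1] <-]; rewrite (le_trans (ler_norm _)) //.
  rewrite (le_trans (HM _ _)) // -mulrA ler_piMr // mulr_ile1 ?norm_ge0 //.
have mS a x : N a <= 1 -> N x <= 1 -> beta a x <= sup S.
  by move=> a1 x1; apply: (sup_upper_bound hS); exists (a, x).
exists (sup S); first exact: (sup_upper_bound hS).
split=> [a x|d d0].
  have [->|a0] := eqVneq a 0; first by rewrite beta0l norm0 mulr0 mul0r.
  have [->|x0] := eqVneq x 0; first by rewrite beta0r norm0 mulr0.
  have Na := norm_gt0 a0; have Nx := norm_gt0 x0.
  have : beta ((N a)^-1 *: a) ((N x)^-1 *: x) <= sup S.
    by apply: mS; rewrite (cj_normZ hV) gtr0_norm ?invr_gt0 // mulVf ?gt_eqF.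
  rewrite betaZl betaZr ler_pdivrMl // ler_pdivrMl //.
  by have -> : sup S * N a * N x = N x * (N a * sup S) by ring.
have [_ [[a x] /= [a1 x1] <-] /ltW dx] := sup_adherent d0 hS.
by exists a, x.
Qed.

(** Choose [a0] and [x0] in the unit ball with [beta a0 x0] close to the norm of
    [beta], and let [w] cut off both.  For [a] and [x] in the unit ball,
    [a0 + w a] and [x0 + w x] have norm nearly one, so [beta] cannot be much
    larger there than at [a0] and [x0]; the mixed terms being small,
    [beta (w a) (w x)] is small.  The rest, [beta a (x - w (w x))], is a sum of two
    inner forms since [1 - w ^ 2] is a combination of [t a0 a0] and [t x0 x0]. *)
Lemma beta_near_inner eps : 0 < eps -> exists b1 e1 b2 e2, forall a x,
  `|beta a x - (inner_form b1 e1 a x + inner_form b2 e2 a x)| <= eps * N a * N x.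
Proof.
move=> eps0; have [m m0 [Hm madh]] := beta_sup.
have [C C0 HC] := cj_bound hV.
have eps2 : 0 < eps / 2 by exact: divr_gt0.
have [a0 [x0 [a01 x01 dax]]] := madh _ eps2.
(* [xi] is small enough for [C * xi <= 1] and for all error terms, which sum
   up to at most [m * (15 * C + 2) * xi], to stay below [eps / 2]. *)
pose K := (m * (15 * C + 2) + 1) / (eps / 2) + C + 1.
have u0 : 0 <= m * (15 * C + 2) by rewrite mulr_ge0 ?addr_ge0 ?mulr_ge0.
have K1 : 0 <= (m * (15 * C + 2) + 1) / (eps / 2).
  by apply: divr_ge0; [rewrite addr_ge0 | exact: ltW].
have K0 : 0 < K by rewrite /K; lra.
pose xi := K^-1; have xi0 : 0 < xi by rewrite invr_gt0.
have Cxi : C * xi <= 1 by rewrite /xi ler_pdivrMr // mul1r /K; lra.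
have mxi : m * (15 * C + 2) * xi <= eps / 2.
  rewrite /xi ler_pdivrMr //.
  have -> : eps / 2 * K = m * (15 * C + 2) + 1 + eps / 2 * C + eps / 2.
    by rewrite /K; field; rewrite gt_eqF.
  have : 0 <= eps / 2 * C by rewrite mulr_ge0 // ltW.
  lra.
have [w1 [G1 [sw1 sG1 w1N w1b [w1a w1G]]]] := cutoff a0 xi0.
have [w2 [G2 [sw2 sG2 w2N w2b [w2x w2G]]]] := cutoff x0 xi0.
pose w x := w1 (w2 x).
have sw : selfadjoint w by exact: selfadjoint_comp.
have wN x : N (w x) <= N x by rewrite (le_trans (w1N _)).
have wb y x : beta (w y) x = beta y (w x).
  by rewrite /w w1b w2b (multiplier_comm _ sw1.1 sw2.1).
have wa : N (w a0) <= xi.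
  by rewrite /w (multiplier_comm _ sw1.1 sw2.1) (le_trans (w2N _)).
have wx : N (w x0) <= xi by rewrite (le_trans (w1N _)).
exists (- 2^-1 *: a0), (G1 a0), (- 2^-1 *: x0), (w1 (w1 (G2 x0))) => a x.
have -> : beta a x - (inner_form (- 2^-1 *: a0) (G1 a0) a x +
    inner_form (- 2^-1 *: x0) (w1 (w1 (G2 x0))) a x) = beta (w a) (w x).
  have sG : selfadjoint (fun y => w1 (w1 (G2 y))).
    by apply: (selfadjoint_comp sw1); exact: (selfadjoint_comp sw1).
  rewrite (inner_form_multiplier _ _ _ sG1) (inner_form_multiplier _ _ _ sG).
  rewrite wb -betaDr -betaNr -betaDr; congr (beta a _).
  rewrite -w1G -w2G /w !(mulB sw1.1) addrA subrK opprB addrC subrK.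
  by rewrite (multiplier_comm (w2 x) sw2.1 sw1.1).
have unit_bound y z : N y <= 1 -> N z <= 1 -> beta (w y) (w z) <= eps.
  move=> y1 z1; have small u v : N u <= 1 -> N (w v) <= xi -> N v <= 1 ->
      N (v + w u) <= 1 + 3 * (C * xi).
    move=> u1 vxi v1; apply: norm_perturbation => //.
    - by apply/andP; split=> //; rewrite mulr_ge0 // ltW.
    - move=> q; rewrite (le_trans (HC _ _ _)) // ler_wpM2r ?norm_ge0 //.
      have := norm_ge0 (w v); have := norm_ge0 u => ? ?.
      by rewrite -mulrA ler_wpM2l // -[leRHS]mulr1 ler_pM.
    - move=> q; rewrite (le_trans (HC _ _ _)) // ler_wpM2r ?norm_ge0 //.
      have := norm_ge0 (w v); have := norm_ge0 u => ? ?.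
      by rewrite -mulrA ler_wpM2l // -[leRHS]mul1r ler_pM.
  have h1 := small y a0 y1 wa a01; have h2 := small z x0 z1 wx x01.
  have := Hm (a0 + w y) (x0 + w z); rewrite !betaE => h3.
  have c1 : - beta a0 (w z) <= m * xi.
    rewrite -wb -betaNl (le_trans (Hm _ _)) // normN -mulrA ler_wpM2l //.
    by rewrite -[leRHS]mulr1 ler_pM ?norm_ge0.
  have c2 : - beta (w y) x0 <= m * xi.
    rewrite wb -betaNr (le_trans (Hm _ _)) // normN -mulrA ler_wpM2l //.
    by rewrite -[leRHS]mul1r ler_pM ?norm_ge0.
  have bd : m * N (a0 + w y) * N (x0 + w z) <= m + 15 * C * (m * xi).
    rewrite -mulrA (le_trans (ler_wpM2l m0 (ler_pM (norm_ge0 _) (norm_ge0 _) h1 h2))) //.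
    have : 0 <= C * xi by rewrite mulr_ge0 // ltW.
    have -> : 15 * C * (m * xi) = 15 * (C * xi) * m by ring.
    move: (C * xi) Cxi => c c1' c0.
    have : (1 + 3 * c) * (1 + 3 * c) <= 1 + 15 * c by nra.
    by move=> /(ler_wpM2l m0); have -> : m * (1 + 15 * c) = m + 15 * c * m by ring.
  move: mxi; have -> : m * (15 * C + 2) * xi = 15 * C * (m * xi) + 2 * (m * xi) by ring.
  by move: (m * xi) (15 * C * (m * xi)) c1 c2 bd => ? ? ? ? ? ?; lra.
have [->|a0'] := eqVneq a 0; first by rewrite (mul0 sw.1) beta0l normr0 norm0 mulr0 mul0r.
have [->|x0'] := eqVneq x 0; first by rewrite (mul0 sw.1) beta0r normr0 norm0 mulr0.
have Na := norm_gt0 a0'; have Nx := norm_gt0 x0'.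
have bound y z : N y = N a -> N z = N x -> beta (w y) (w z) <= eps * N a * N x.
  move=> ya zx.
  have : beta (w ((N a)^-1 *: y)) (w ((N x)^-1 *: z)) <= eps.
    by apply: unit_bound; rewrite (cj_normZ hV) gtr0_norm ?invr_gt0 ?ya ?zx // mulVf ?gt_eqF.
  rewrite !(mulZ sw.1) betaZl betaZr ler_pdivrMl // ler_pdivrMl //.
  by have -> : eps * N a * N x = N x * (N a * eps) by ring.
rewrite ler_norml bound // andbT lerNl -betaNl -(mulN sw.1).
by apply: bound => //; rewrite normN.
Qed.

End CommutativeTriple.

(** * Real and complex scalars at once *)

(** The common ground of the real and the complex case: [iota] embeds the real
    numbers into the scalars, and absolute values are real numbers. *)
Record real_scalars (R : realType) (K : numFieldType) (re : K -> R)
    (conj : {rmorphism K -> K}) (iota : {rmorphism R -> K}) : Prop := RealScalars {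
  rs_linear : forall r k l, re (iota r * k + l) = r * re k + re l;
  rs_reK : forall r, re (iota r) = r;
  rs_norm : forall k : K, iota (re `|k|) = `|k|;
  rs_le : forall r s, (iota r <= iota s) = (r <= s);
  rs_re_le : forall k : K, `|re k| <= re `|k|;
  rs_conjK : involutive conj;
  rs_conj_iota : forall r, conj (iota r) = iota r;
  rs_re_conj : forall k, re (conj k) = re k;
  rs_norm_conj : forall k : K, `|conj k| = `|k| }.

Lemma real_scalars_real (R : realType) : @real_scalars R R idfun idfun idfun.
Proof. by split=> // k; exact: normr_id || exact: ler_norm. Qed.

Lemma real_scalars_complex (R : realType) :
  @real_scalars R R[i] (@complex.Re R) (@conjc R) (real_complex R).
Proof.
split=> //.
- by move=> r [a b] [c d] /=; rewrite mul0r subr0.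
- by move=> r s; exact: lecR.
- by move=> k; rewrite -lecR (RRe_real (normr_real k)) normc_ge_Re.
- exact: conjcK.
- by move=> r; rewrite /= oppr0.
- by case.
- exact: normcJ.
Qed.

Section RealNorm.
Variables (R : realType) (K : numFieldType) (re : K -> R).
Variables (conj : {rmorphism K -> K}) (iota : {rmorphism R -> K}).
Hypothesis hK : real_scalars re conj iota.

Lemma re0 : re 0 = 0.
Proof. by rewrite -(rmorph0 iota) (rs_reK hK). Qed.
Lemma reD k l : re (k + l) = re k + re l.
Proof. by have := rs_linear hK 1 k l; rewrite rmorph1 !mul1r. Qed.
Lemma reM r k : re (iota r * k) = r * re k.
Proof. by have := rs_linear hK r k 0; rewrite re0 !addr0. Qed.
Lemma reN k : re (- k) = - re k.
Proof. by have := reM (-1) k; rewrite rmorphN1 !mulN1r. Qed.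
Lemma reB k l : re (k - l) = re k - re l.
Proof. by rewrite reD reN. Qed.

Lemma iota_lt r s : (iota r < iota s) = (r < s).
Proof.
rewrite !lt_neqAle (rs_le hK); congr (~~ _ && _).
by apply/eqP/eqP => [/(congr1 re)|-> //]; rewrite !(rs_reK hK).
Qed.

Definition rnorm (V : normedModType K) (x : V) : R := re `|x|.

Section Norm.
Variable V : normedModType K.
Implicit Types x y : V.

Lemma iota_rnorm x : iota (rnorm x) = `|x|.
Proof. by rewrite /rnorm -(normr_id x) (rs_norm hK). Qed.

Lemma rnorm_le x r : (`|x| <= iota r) = (rnorm x <= r).
Proof. by rewrite -iota_rnorm (rs_le hK). Qed.

Lemma rnorm_lt x r : (`|x| < iota r) = (rnorm x < r).
Proof. by rewrite -iota_rnorm iota_lt. Qed.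

Lemma rnorm_ge0 x : 0 <= rnorm x.
Proof. by rewrite -(rs_le hK) rmorph0 iota_rnorm. Qed.

Lemma rnormD x y : rnorm (x + y) <= rnorm x + rnorm y.
Proof. by rewrite -rnorm_le rmorphD /= !iota_rnorm ler_normD. Qed.

Lemma rnormN x : rnorm (- x) = rnorm x.
Proof. by rewrite /rnorm normrN. Qed.

Lemma rnormB x y : rnorm (x - y) <= rnorm x + rnorm y.
Proof. by rewrite -[rnorm y]rnormN rnormD. Qed.

Lemma rnormZ k x : rnorm (k *: x) = re `|k| * rnorm x.
Proof. by rewrite /rnorm normrZ -(rs_norm hK k) reM (rs_norm hK). Qed.

Lemma norm_iota r : `|iota r| = iota `|r|.
Proof.
wlog r0 : r / 0 <= r.
  case: (lerP 0 r) => [?|r0] W; first exact: W.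
  by rewrite -normrN -rmorphN W ?normrN ?oppr_ge0 ?ltW.
by rewrite !ger0_norm // -(rmorph0 iota) (rs_le hK).
Qed.

Lemma rnormZr r x : rnorm (iota r *: x) = `|r| * rnorm x.
Proof. by rewrite rnormZ norm_iota (rs_reK hK). Qed.

Lemma rnorm0 : rnorm (0 : V) = 0.
Proof. by rewrite /rnorm normr0 re0. Qed.

Lemma rnorm_eq0 x : rnorm x = 0 -> x = 0.
Proof. by move=> x0; apply/eqP; rewrite -normr_eq0 -iota_rnorm x0 rmorph0. Qed.

Lemma rnorm_gt0 x : x != 0 -> 0 < rnorm x.
Proof.
move=> x0; rewrite lt_neqAle rnorm_ge0 andbT eq_sym.
by apply: contra_neq x0; exact: rnorm_eq0.
Qed.

Lemma gt0_iota (e : K) : 0 < e -> exists2 d, 0 < d & e = iota d.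
Proof.
move=> e0; exists (re `|e|); last by rewrite (rs_norm hK) gtr0_norm.
by rewrite -iota_lt rmorph0 (rs_norm hK) normr_gt0 gt_eqF.
Qed.

Lemma near_rnorm (P : set V) x :
  nbhs x P <-> exists2 d, 0 < d & forall y, rnorm (x - y) < d -> P y.
Proof.
split=> [/nbhs_normP[_ /= /gt0_iota[d d0 ->]] H|[d d0 H]].
  by exists d => // y xy; apply: H; rewrite /ball_ /= rnorm_lt.
apply/nbhs_normP; exists (iota d) => /=; first by rewrite -(rmorph0 iota) iota_lt.
by move=> y /=; rewrite rnorm_lt; exact: H.
Qed.

End Norm.

Lemma continuous_rnormP (V W : normedModType K) (f : V -> W) x :
  {for x, continuous f} <-> forall e : R, 0 < e ->
    exists2 d, 0 < d & forall y, rnorm (x - y) < d -> rnorm (f x - f y) < e.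
Proof.
split=> [fx e e0|H].
  apply/near_rnorm; have := fx [set z | rnorm (f x - z) < e]; apply.
  by apply/near_rnorm; exists e.
move=> A /near_rnorm[e e0 eA]; have /near_rnorm := H e e0.
by apply: filterS => y; exact: eA.
Qed.

Section Dual.
Variable V : normedModType K.

Lemma is_dual_bounded (phi : V -> K) : is_dual phi ->
  exists2 C : R, 0 <= C & forall x, re `|phi x| <= C * rnorm x.
Proof.
move=> [lphi cphi].
have phi0 : phi 0 = 0 by have := lphi (-1) 0 0; rewrite scaleN1r oppr0 add0r mulN1r addNr.
have phiZ k x : phi (k *: x) = k * phi x by have := lphi k x 0; rewrite phi0 !addr0.
have [d d0 H] := (@continuous_rnormP V K^o phi 0).1 (cphi 0) 1 ltr01.
exists (2 / d) => [|x]; first by rewrite divr_ge0 // ltW.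
have [->|x0] := eqVneq x 0; first by rewrite phi0 normr0 re0 rnorm0 mulr0.
have nx := rnorm_gt0 x0.
have c0 : 0 < d / (2 * rnorm x) by rewrite divr_gt0 // mulr_gt0.
have := H (iota (d / (2 * rnorm x)) *: x).
rewrite phi0 !sub0r !rnormN rnormZr gtr0_norm // phiZ.
rewrite -[iota _ * _]/(iota _ *: (phi x : K^o)) rnormZr gtr0_norm //.
have -> : d / (2 * rnorm x) * rnorm x = d / 2 by field; rewrite gt_eqF.
rewrite ltr_pdivrMr // ltr_pMr // ltr1n => /(_ isT) /ltW.
have -> : 2 / d * rnorm x = (d / (2 * rnorm x))^-1 * 1.
  by field; rewrite !gt_eqF.
by rewrite ler_pdivlMl.
Qed.

Lemma is_dual_of_bounded (phi : V -> K) (C : R) : scalar phi -> 0 <= C ->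
  (forall x, re `|phi x| <= C * rnorm x) -> is_dual phi.
Proof.
move=> lphi C0 HC; split=> // x; apply/continuous_rnormP => e e0.
exists (e / (C + 1)); first by rewrite divr_gt0 // ltr_wpDl.
move=> y; rewrite ltr_pdivlMr ?ltr_wpDl // => xy.
have -> : phi x - phi y = phi (x - y).
  by have := lphi (-1) y x; rewrite scaleN1r mulN1r ![- _ + _]addrC.
apply: le_lt_trans (HC _) _; apply: le_lt_trans xy.
by rewrite mulrC ler_wpM2l ?rnorm_ge0 // lerDl.
Qed.

End Dual.


(** * Continuous ternary derivations as bounded forms *)

Section NormedTriple.
Variables (E : normedModType K) (tp : E -> E -> E -> E).
Hypothesis hE : is_jordan_normed_triple conj tp.

Lemma tp_0l b c : tp 0 b c = 0.
Proof.
have := tp_outer_linear hE.1 b c 1 0 0; rewrite !scale1r addr0 => /eqP.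
by rewrite -subr_eq subrr eq_sym => /eqP.
Qed.
Lemma tp_0m a c : tp a 0 c = 0.
Proof.
have := tp_middle_conj_linear hE.1 a c 1 0 0.
rewrite rmorph1 !scale1r addr0 => /eqP.
by rewrite -subr_eq subrr eq_sym => /eqP.
Qed.
Lemma tp_Zl k a b c : tp (k *: a) b c = k *: tp a b c.
Proof. by have := tp_outer_linear hE.1 b c k a 0; rewrite tp_0l !addr0. Qed.
Lemma tp_Zr k a b c : tp a b (k *: c) = k *: tp a b c.
Proof. by rewrite !(tp_outer_sym hE.1 a) tp_Zl. Qed.
Lemma tp_0r a b : tp a b 0 = 0.
Proof. by rewrite (tp_outer_sym hE.1) tp_0l. Qed.
Lemma tp_Zm k a b c : tp a (k *: b) c = conj k *: tp a b c.
Proof. by have := tp_middle_conj_linear hE.1 a c k b 0; rewrite tp_0m !addr0. Qed.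
Lemma tp_lin_l k a a' b c : tp (k *: a + a') b c = k *: tp a b c + tp a' b c.
Proof. exact: tp_outer_linear hE.1 b c k a a'. Qed.
Lemma tp_lin_r k a b c c' : tp a b (k *: c + c') = k *: tp a b c + tp a b c'.
Proof. by rewrite !(tp_outer_sym hE.1 a) tp_lin_l. Qed.
Lemma tp_lin_m k a b b' c : tp a (k *: b + b') c = conj k *: tp a b c + tp a b' c.
Proof. exact: tp_middle_conj_linear hE.1 a c k b b'. Qed.

Lemma tp_bounded : exists2 C : R, 0 <= C &
  forall a b c, rnorm (tp a b c) <= C * rnorm a * rnorm b * rnorm c.
Proof.
pose A : set E := [set z | rnorm (0 - z) < 1].
have A0 : nbhs (tp 0 0 0) A.
  by rewrite tp_0l; apply/near_rnorm; exists 1.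
have /nbhs_ballP[_ /= /gt0_iota[d d0 ->] H] := hE.2 (0, 0, 0) A A0.
have small a b c : rnorm a < d -> rnorm b < d -> rnorm c < d ->
    rnorm (tp a b c) < 1.
  move=> ad bd cd; have := H ((a, b), c).
  rewrite /A /= sub0r rnormN; apply.
  by split; [split|]; rewrite -ball_normE /= sub0r normrN rnorm_lt.
have d2 : 0 < 2 / d by rewrite divr_gt0.
exists ((2 / d) ^+ 3) => [|a b c]; first by rewrite exprn_ge0 // ltW.
have [->|a0] := eqVneq a 0; first by rewrite tp_0l rnorm0 mulr0 !mul0r.
have [->|b0] := eqVneq b 0; first by rewrite tp_0m rnorm0 mulr0 mul0r.
have [->|c0] := eqVneq c 0; first by rewrite tp_0r rnorm0 mulr0.
have na := rnorm_gt0 a0; have nb := rnorm_gt0 b0; have nc := rnorm_gt0 c0.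
pose k (x : E) := d / 2 / rnorm x.
have k0 x : 0 < rnorm x -> 0 < k x by move=> x0; rewrite !divr_gt0.
have kx x : 0 < rnorm x -> rnorm (iota (k x) *: x) < d.
  move=> x0; rewrite rnormZr gtr0_norm ?k0 // /k divfK ?gt_eqF //.
  by rewrite ltr_pdivrMr // ltr_pMr // ltr1n.
have := small _ _ _ (kx _ na) (kx _ nb) (kx _ nc).
rewrite tp_Zl tp_Zm tp_Zr (rs_conj_iota hK) !rnormZr !gtr0_norm ?k0 //.
move=> /ltW H'.
have -> : (2 / d) ^+ 3 * rnorm a * rnorm b * rnorm c =
   (k a)^-1 * ((k b)^-1 * ((k c)^-1 * 1)).
  by rewrite /k; field; rewrite !gt_eqF.
rewrite !ler_pdivlMl ?k0 //.
by rewrite [k c * _]mulrCA [k c * _]mulrCA [k b * _]mulrCA.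
Qed.

Hypothesis hc : is_commutative_triple tp.

Lemma tp_commuting : commuting_triple tp.
Proof.
split; [exact: tp_outer_sym hE.1 | exact: tp_jordan_identity hE.1 | exact: hc].
Qed.

Let ht := tp_commuting.

Definition bounded_form (D : E -> E -> K) :=
  exists2 M : R, 0 <= M & forall a x, re `|D a x| <= M * rnorm a * rnorm x.

Definition bounded_derivation D := is_ternary_derivation conj tp D /\ bounded_form D.

Lemma bounded_derivation_of (D : E -> E -> K) :
  (forall a, scalar (D a)) ->
  (forall k a b x, D (k *: a + b) x = conj k * D a x + D b x) ->
  (forall a b c x, D (tp a b c) x = D a (tp b c x) + conj (D b (tp a x c)) + D c (tp b a x)) ->
  bounded_form D -> bounded_derivation D.
Proof.
move=> Dlin Dconj Dleib [M M0 HM]; split; last by exists M.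
split=> // a; apply: (is_dual_of_bounded (C := M * rnorm a)) => //.
by rewrite mulr_ge0 ?rnorm_ge0.
Qed.

Lemma re_normD (k l : K) : re `|k + l| <= re `|k| + re `|l|.
Proof. exact: (rnormD (k : K^o) (l : K^o)). Qed.
Lemma re_normN (k : K) : re `|- k| = re `|k|.
Proof. by rewrite normrN. Qed.

Lemma bounded_derivation0 : bounded_derivation (fun _ _ => 0).
Proof.
apply: bounded_derivation_of.
- by move=> a k x y; rewrite mulr0 addr0.
- by move=> k *; rewrite mulr0 addr0.
- by move=> *; rewrite rmorph0 !addr0.
- by exists 0 => // a x; rewrite normr0 re0 !mul0r.
Qed.

Lemma bounded_derivationD D D' : bounded_derivation D -> bounded_derivation D' ->
  bounded_derivation (fun a x => D a x + D' a x).
Proof.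
move=> [[d1 c1 l1] [M M0 HM]] [[d2 c2 l2] [M' M'0 HM']].
apply: bounded_derivation_of.
- move=> a k x y; rewrite (d1 a).1 (d2 a).1 /=.
  by rewrite mulrDr addrACA.
- by move=> k a b x; rewrite c1 c2 mulrDr addrACA.
- move=> a b c x; rewrite l1 l2 /dual_tp_l /dual_tp_m /dual_tp_r rmorphD /=.
  by rewrite (AC (3*3) ((1*4)*(2*5)*(3*6))).
- exists (M + M') => [|a x]; first exact: addr_ge0.
  by rewrite !mulrDl (le_trans (re_normD _ _)) // lerD.
Qed.

(** The eight values of [phi] in the Leibniz rule involve only two different
    five-fold products, and for each of them the signs add up. *)
Lemma bounded_derivation_inner b phi : is_dual phi ->
  bounded_derivation (inner_tder conj tp b phi).
Proof.
move=> /[dup] [[lphi _]] /is_dual_bounded[C C0 HC].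
have phiD x y : phi (x + y) = phi x + phi y.
  by have := lphi 1 x y; rewrite !scale1r mul1r.
have phi_lin k x y : phi (k *: x + y) = k * phi x + phi y by exact: lphi.
have [L L0 HL] := tp_bounded.
rewrite /inner_tder /dual_tp_m /dual_tp_l /dual_tp_r.
apply: bounded_derivation_of.
- move=> a k x y; rewrite tp_lin_m tp_lin_r !phi_lin rmorphD rmorphM /= (rs_conjK hK).
  by rewrite mulrBr opprD addrACA.
- move=> k a a' x; rewrite tp_lin_r tp_lin_m !phi_lin rmorphD rmorphM /=.
  by rewrite mulrBr opprD addrACA.
- move=> a c d x.
  have e1 : tp b (tp c d x) a = tp b x (tp a c d).
    by rewrite (t_middle ht) hc (ct_sym ht d).
  have e2 : tp b c (tp a x d) = tp b x (tp a c d) by rewrite (t_swap ht).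
  have e3 : tp b (tp c a x) d = tp b x (tp a c d) by rewrite (t_middle ht) hc.
  have e4 : tp b a (tp c d x) = tp b (tp a c d) x.
    by rewrite (t_middle ht) hc (t_swap ht).
  have e5 : tp b (tp a x d) c = tp b (tp a c d) x.
    by rewrite !(t_middle ht) hc (ct_sym ht x) hc.
  have e6 : tp b d (tp c a x) = tp b (tp a c d) x by rewrite (t_middle ht) hc.
  rewrite e1 e2 e3 e4 e5 e6 rmorphB /= (rs_conjK hK).
  by rewrite subrKA subrr add0r.
- exists (C * L * rnorm b *+ 2) => [|a x].
    by rewrite mulrn_wge0 // !mulr_ge0 ?rnorm_ge0.
  have h u v w : re `|phi (tp u v w)| <= C * (L * rnorm u * rnorm v * rnorm w).
    by rewrite (le_trans (HC _)) // ler_wpM2l.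
  rewrite (le_trans (re_normD _ _)) // re_normN (rs_norm_conj hK).
  have -> : C * L * rnorm b *+ 2 * rnorm a * rnorm x =
    C * (L * rnorm b * rnorm x * rnorm a) + C * (L * rnorm b * rnorm a * rnorm x).
    by ring.
  exact: lerD.
Qed.

Lemma bounded_derivation_sum n (b : 'I_n -> E) (phi : 'I_n -> E -> K) :
  (forall i, is_dual (phi i)) ->
  bounded_derivation (fun a x => \sum_(i < n) inner_tder conj tp (b i) (phi i) a x).
Proof.
move=> hphi; elim: (index_enum _) => [|i s IH].
  have := bounded_derivation0; congr bounded_derivation.
  by apply/funext => a; apply/funext => x; rewrite big_nil.
have := bounded_derivationD (bounded_derivation_inner (b i) (hphi i)) IH.
congr bounded_derivation.
by apply/funext => a; apply/funext => x; rewrite big_cons.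
Qed.

Lemma dual_norm_le (phi : E -> K) (c : R) :
  (forall x, rnorm x <= 1 -> re `|phi x| <= c) -> (dual_norm re phi <= c%:E)%E.
Proof.
move=> H; apply: ge_ereal_sup => _ [x /= x1 <-]; rewrite lee_fin H //.
by rewrite -rnorm_le rmorph1.
Qed.

Lemma dual_norm_lt (phi : E -> K) (c : R) x :
  (dual_norm re phi < c%:E)%E -> rnorm x <= 1 -> re `|phi x| < c.
Proof.
move=> H x1; rewrite -lte_fin; apply: le_lt_trans H.
by apply: ereal_sup_ubound; exists x => //=; rewrite -(rmorph1 iota) rnorm_le.
Qed.

(** It suffices to bound the values on pairs from the unit balls, for the operator
    norm is a supremum of suprema. *)
Lemma opnorm_dual_le (T : E -> E -> K) (c : R) :
  (forall a x, rnorm a <= 1 -> rnorm x <= 1 -> re `|T a x| <= c) ->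
  (opnorm (dual_norm re (V:=E)) T <= c%:E)%E.
Proof.
move=> H; apply: ge_ereal_sup => _ [a /= a1 <-]; apply: dual_norm_le => x x1.
by apply: H => //; rewrite -rnorm_le rmorph1.
Qed.

Lemma bounded_derivation_continuous D : bounded_derivation D ->
  continuous_ternary_derivations re conj tp D.
Proof.
move=> [dD [M M0 HM]]; split=> // a e e0.
apply/near_rnorm; exists (e / (M + 1)); first by rewrite divr_gt0 // ltr_wpDl.
move=> b; rewrite ltr_pdivlMr ?ltr_wpDl // => ab.
apply: (@le_lt_trans _ _ (M * rnorm (a - b))%:E); last first.
  rewrite lte_fin; apply: le_lt_trans ab.
  by rewrite mulrC ler_wpM2l ?rnorm_ge0 // lerDl.
apply: dual_norm_le => x x1.
have -> : D b x - D a x = D (b - a) x.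
  have := tder_conj_linear dD (-1) a b x.
  by rewrite scaleN1r rmorphN1 mulN1r ![- _ + _]addrC.
rewrite (le_trans (HM _ _)) // -(rnormN (b - a)) opprB.
by rewrite ler_piMr // mulr_ge0 ?rnorm_ge0.
Qed.

(** Continuity at zero gives a bound on a ball.  Only real multiples of [a] and
    [x] are taken, on which conjugate linear and linear maps agree. *)
Lemma continuous_derivation_bounded D :
  continuous_ternary_derivations re conj tp D -> bounded_form D.
Proof.
move=> [dD cD].
have D0 x : D 0 x = 0.
  have := tder_conj_linear dD (-1) 0 0 x.
  by rewrite scaleN1r oppr0 addr0 rmorphN1 mulN1r addNr.
have DZ r a x : D (iota r *: a) x = iota r * D a x.
  by have := tder_conj_linear dD (iota r) a 0 x; rewrite D0 !addr0 (rs_conj_iota hK).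
have [Dd _ _] := dD.
have DZr r a x : D a (iota r *: x) = iota r * D a x.
  have lin := (Dd a).1; have D0r : D a 0 = 0.
    by have := lin (-1) 0 0; rewrite scaleN1r oppr0 add0r mulN1r addNr.
  by have := lin (iota r) x 0; rewrite D0r !addr0.
have /near_rnorm[d d0 H] := cD 0 1 ltr01.
exists (2 / d) => [|a x]; first by rewrite divr_ge0 // ltW.
have [->|a0] := eqVneq a 0; first by rewrite D0 normr0 re0 rnorm0 mulr0 mul0r.
have [->|x0] := eqVneq x 0.
  have := DZr 0 a 0; rewrite rmorph0 mul0r scale0r => ->.
  by rewrite normr0 re0 rnorm0 mulr0.
have na := rnorm_gt0 a0; have nx := rnorm_gt0 x0.
pose k := d / (2 * rnorm a).
have k0 : 0 < k by rewrite divr_gt0 // mulr_gt0.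
have ka : rnorm (0 - iota k *: a) < d.
  rewrite sub0r rnormN rnormZr gtr0_norm //.
  have -> : k * rnorm a = d / 2 by rewrite /k; field; rewrite gt_eqF.
  by rewrite ltr_pdivrMr // ltr_pMr // ltr1n.
have := dual_norm_lt (x := iota (rnorm x)^-1 *: x) (H _ ka).
rewrite rnormZr gtr0_norm ?invr_gt0 // mulVf ?gt_eqF // => /(_ (lexx _)).
have nx' : 0 < (rnorm x)^-1 by rewrite invr_gt0.
rewrite D0 subr0 DZ DZr !normrM !norm_iota (gtr0_norm k0) (gtr0_norm nx') !reM => /ltW.
have -> : 2 / d * rnorm a * rnorm x = rnorm x * (k^-1 * 1).
  by rewrite /k; field; rewrite !gt_eqF.
by rewrite -ler_pdivrMl // ler_pdivlMl // mulrCA.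
Qed.

Lemma inner_sub_continuous :
  inner_ternary_derivations conj tp `<=` continuous_ternary_derivations re conj tp.
Proof.
move=> D [n [b [phi [hphi HD]]]]; apply: bounded_derivation_continuous.
have := bounded_derivation_sum b hphi; congr bounded_derivation.
by apply/funext => a; apply/funext => x; rewrite HD.
Qed.

End NormedTriple.

End RealNorm.

(** * Subtriples of a JB-star triple as real triples *)

(** A separate type, so that the real scalar multiplication does not compete
    with the one over [K]. *)
Definition realified (R K : pzRingType) (iota : {rmorphism R -> K})
  (V : lmodType K) : Type := V.

Section Realified.
Variables (R K : pzRingType) (iota : {rmorphism R -> K}) (V : lmodType K).
Local Notation W := (realified iota V).
HB.instance Definition _ := GRing.Zmodule.on W.
Fact realified_scaleA (a b : R) (v : W) :
  iota a *: (iota b *: (v : V)) = iota (a * b) *: (v : V).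
Proof. by rewrite scalerA rmorphM. Qed.
Fact realified_scale1 (v : W) : iota 1 *: (v : V) = v.
Proof. by rewrite rmorph1 scale1r. Qed.
Fact realified_scaleDr (a : R) (v w : W) :
  iota a *: ((v + w : W) : V) = iota a *: (v : V) + iota a *: (w : V) :> V.
Proof. exact: scalerDr. Qed.
Fact realified_scaleDl (v : W) (a b : R) :
  iota (a + b) *: (v : V) = iota a *: (v : V) + iota b *: (v : V).
Proof. by rewrite rmorphD scalerDl. Qed.
HB.instance Definition _ := GRing.Zmodule_isLmodule.Build R W
  realified_scaleA realified_scale1 realified_scaleDr realified_scaleDl.
End Realified.

Section Embedding.
Variables (R : realType) (K : numFieldType) (re : K -> R).
Variables (conj : {rmorphism K -> K}) (iota : {rmorphism R -> K}).
Hypothesis hK : real_scalars re conj iota.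
Variables (E : normedModType K) (tp : E -> E -> E -> E).
Hypothesis hE : is_jordan_normed_triple conj tp.
Hypothesis hc : is_commutative_triple tp.
Variables (F : completeNormedModType R[i]) (tF : F -> F -> F -> F) (j : E -> F).
Hypothesis hF : is_JBstar_triple tF.
Hypothesis hj : forall r x y, j (iota r *: x + y) = (r%:C)%C *: j x + j y.
Hypothesis hjn : forall x, rnorm re x = rnorm (@complex.Re R) (j x).
Hypothesis hjt : forall a b c, j (tp a b c) = tF (j a) (j b) (j c).
Hypothesis hjc : closed (range j).

Let hC := real_scalars_complex R.
Let hFJ : is_jordan_normed_triple (@conjc R) tF := JBstar_jordan_banach hF.
Local Notation N := (@rnorm R K re E).
Local Notation NF := (@rnorm R R[i] (@complex.Re R) F).

(** The second term comes last because linearity is stated for [k *: x + y]. *)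
Definition complex_norm (x y : E) : R := NF ('i%C *: j y + j x).

Let jD x y : j (x + y) = j x + j y.
Proof. by have := hj 1 x y; rewrite rmorph1 !scale1r. Qed.
Let j0 : j 0 = 0.
Proof. by have /eqP := jD 0 0; rewrite addr0 -subr_eq subrr eq_sym => /eqP. Qed.
Let jN x : j (- x) = - j x.
Proof. by apply/eqP; rewrite -addr_eq0 -jD addNr j0. Qed.

Lemma JB_cube (z : F) : NF (tF z z z) = NF z ^+ 3.
Proof.
rewrite /rnorm (JBstar_norm hF) -(iota_rnorm hC z) -rmorphXn /=.
exact: (rs_reK hC).
Qed.

Lemma rnorm_i (z : F) : NF ('i%C *: z) = NF z.
Proof. by rewrite (rnormZ hC) normc_def expr0n expr1n add0r sqrtr1 /= mul1r. Qed.

Lemma complex_norm_cube x y : complex_norm x y ^+ 3 =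
  complex_norm (tp x x x + tp x y y *+ 2 - tp y x y)
               (tp x x y *+ 2 - tp x y x + tp y y y).
Proof.
rewrite /complex_norm -JB_cube; congr rnorm.
rewrite !mulr2n !(jD, jN, hjt); move: (j x) (j y) => u v.
rewrite (tp_lin_l hFJ) !(tp_lin_m hFJ) !(tp_lin_r hFJ).
rewrite (tp_outer_sym hFJ.1 v v u) (tp_outer_sym hFJ.1 v u u).
have -> : (@conjc R : {rmorphism R[i] -> R[i]}) 'i%C = - 'i%C.
  by apply/eqP; rewrite eq_complex /= oppr0 !eqxx.
rewrite !(scalerDr, scalerN, scalerA) !(mulrN, mulNr) -expr2 sqr_i mulN1r !opprK.
rewrite !(scaleNr, scale1r, opprK).
by rewrite (AC (2*2*(2*2)) ((4*7*6*1)*((8*(2*5))*3)))/=.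
Qed.

(** The iteration of [z |-> y + T z] converges in [F], and its limit stays in the
    image of [E] because that image is closed. *)
Lemma fixed_point (T : realified iota E -> realified iota E) (q : R) :
  linear T -> 0 <= q < 1 -> (forall x, N (T x) <= q * N x) ->
  forall y, exists z, z = y + T z.
Proof.
move=> lT /andP[q0 q1] Tq y.
pose z n := iter n (fun x : E => y + T x) 0.
pose B := N y / (1 - q).
have q1' : 0 < 1 - q by rewrite subr_gt0.
have B0 : 0 <= B by rewrite divr_ge0 ?(rnorm_ge0 hK) // ltW.
have TB (x x' : E) : T (x - x') = T x - T x'.
  have := lT (-1) x' x; rewrite !scaleN1r => H.
  by rewrite addrC H addrC.
have zB n : N (z n) <= B.
  elim: n => [|n IH]; first by rewrite (rnorm0 hK).
  apply: le_trans (rnormD hK _ _) _.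
  have /(le_trans (Tq (z n))) : q * N (z n) <= q * B by rewrite ler_wpM2l.
  have : N y = B * (1 - q) by rewrite /B divfK // gt_eqF.
  by rewrite /=; lra.
have zm m n : N (z (m + n)%N - z m) <= q ^+ m * B.
  elim: m => [|m IH]; first by rewrite add0n subr0 mul1r.
  have -> : z (m.+1 + n)%N - z m.+1 = T (z (m + n)%N - z m).
    by rewrite TB /= opprD addrACA subrr add0r.
  by rewrite exprS -mulrA (le_trans (Tq _)) // ler_wpM2l.
have small e : 0 < e -> exists m, q ^+ m * B < e.
  move=> e0; have := @cvg_geometric R B q.
  rewrite ger0_norm // => /(_ q1) /cvgrPdist_lt /(_ e e0) [m _ H].
  exists m; have := H m (leqnn m); rewrite sub0r normrN /geometric /= mulrC.
  by apply: le_lt_trans; exact: ler_norm.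
have jB (x x' : E) : NF (j x - j x') = N (x - x') by rewrite -jN -jD -hjn.
have cz : cvgn (j \o z).
  apply/cauchy_cvgP/cauchy_exP => _ /(gt0_iota hC)[e e0 ->].
  have [m me] := small e e0; exists (j (z m)); exists m => // n /= mn.
  rewrite -ball_normE /= (rnorm_lt hC) -(rnormN _ (_ - _)) opprB jB.
  by rewrite -(subnKC mn) (le_lt_trans (zm _ _)).
have [x _ xl] : range j (limn (j \o z)).
  by apply: (closed_cvg _ hjc _ _ cz) => //; apply: nearW => n; exists (z n).
exists x; apply/eqP; rewrite -subr_eq0; apply/eqP/(rnorm_eq0 hK).
apply/eqP; rewrite eq_le (rnorm_ge0 hK) andbT; apply/ler_addgt0Pl => e e0.
have e2 : 0 < e / 2 by exact: divr_gt0.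
have : nbhs (j x) [set w | NF (j x - w) < e / 2].
  by apply/(near_rnorm hC); exists (e / 2).
rewrite xl => /cz [m _ H].
have hm k : (m <= k)%N -> N (x - z k) < e / 2.
  by move=> mk; rewrite -jB; have := H k mk; rewrite /= -xl.
rewrite addr0.
have -> : x - (y + T x) = (x - z m.+1) - T (x - z m).
  rewrite TB /= opprB !opprD -[RHS]addrA; congr (x + _).
  by rewrite addrA subrK.
have h1 := rnormB hK (x - z m.+1) (T (x - z m)).
have h2 := Tq (x - z m); have h3 := hm m (leqnn m); have h4 := hm m.+1 (leqnSn m).
have h5 : q * N (x - z m) <= N (x - z m) by rewrite ler_piMl ?(rnorm_ge0 hK) // ltW.
by move: h1 h2 h3 h4 h5; lra.
Qed.

Lemma embedded_JB : @commutative_JB R (realified iota E) tp N complex_norm.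
Proof.
have [C C0 HC] := tp_bounded hK hE.
have double (x : E) : x + x = iota 2 *: x.
  by rewrite rmorphD rmorph1 scalerDl scale1r.
split.
- by move=> b c k x y; exact: (tp_lin_l hE).
- move=> a c k x y; have := tp_lin_m hE (iota k) a x y c.
  by rewrite (rs_conj_iota hK).
- exact: (tp_commuting hE hc).
- exact: (rnormD hK).
- exact: (rnormZr hK).
- exact: (rnorm_eq0 hK).
- by move=> x; rewrite hjn hjt JB_cube -hjn.
- by exists C.
- exact: fixed_point.
- move=> x y; rewrite /complex_norm jN scalerN -mulr_natl.
  have -> : 2%:R * N x = NF (('i%C *: j y + j x) + (- ('i%C *: j y) + j x)).
    rewrite addrACA subrr add0r -jD -hjn double.
    by rewrite (rnormZr hK) ger0_norm.
  exact: (rnormD hC).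
- move=> x y; rewrite /complex_norm jN scalerN -mulr_natl.
  have -> : 2%:R * N y = NF (('i%C *: j y + j x) - (- ('i%C *: j y) + j x)).
    rewrite opprD opprK addrACA subrr addr0 -scalerDr rnorm_i -jD -hjn.
    by rewrite double (rnormZr hK) ger0_norm.
  exact: (rnormB hC).
- move=> x y; rewrite (le_trans (rnormD hC _ _)) // rnorm_i -!hjn.
  by rewrite addrC.
- by move=> x y; exact: (rnorm_ge0 hC).
- exact: complex_norm_cube.
Qed.

(** * Density of the inner ternary derivations *)

(** The approximating inner derivation is found for the real form [re (D a x)].
    Its first arguments [b_i] and the functionals [D e_i] also define an inner
    derivation over the scalar field, and rotating [x] by a scalar of modulus
    one turns the estimate of the real part into one of the absolute value. *)
Theorem almost_ternary_weakly_amenable_embedded :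
  almost_ternary_weakly_amenable re conj tp.
Proof.
split; first exact: (inner_sub_continuous hK hE hc).
move=> D cD e e0.
have [M M0 HM] := continuous_derivation_bounded hK cD.
have [dD _] := cD.
pose beta (a x : realified iota E) := re (D a x).
have Dlin a : scalar (D a) by case: (tder_dual dD a).
have hb : @derivation_form R (realified iota E) tp N beta.
  split.
  - move=> x k a b; rewrite /beta.
    have := tder_conj_linear dD (iota k) a b x; rewrite (rs_conj_iota hK) => ->.
    exact: (rs_linear hK).
  - move=> a k x y; rewrite /beta.
    have := Dlin a (iota k) x y => ->.
    exact: (rs_linear hK).
  - move=> a b c x; rewrite /beta (tder_leibniz dD) !(reD hK).
    by rewrite /dual_tp_m (rs_re_conj hK).
  - by exists M => // a x; rewrite (le_trans (rs_re_le hK _)).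
have e2 : 0 < e / 2 by exact: divr_gt0.
have [b1 [e1 [b2 [e2' H]]]] := beta_near_inner embedded_JB hb e2.
pose b (i : 'I_2) : E := if i == ord0 then b1 else b2.
pose phi (i : 'I_2) : E -> K := D (if i == ord0 then e1 else e2').
pose d a x := \sum_(i < 2) inner_tder conj tp (b i) (phi i) a x.
have hphi i : is_dual (phi i) := tder_dual dD _.
exists d; first by exists 2%N, b, phi.
have [dd _] := bounded_derivation_sum hK hE hc b hphi.
have re_d a x : re (d a x) =
    @inner_form R (realified iota E) tp beta b1 e1 a x
    + @inner_form R (realified iota E) tp beta b2 e2' a x.
  rewrite /d !big_ord_recl big_ord0 addr0 (reD hK) /inner_tder !(reB hK).
  by rewrite /dual_tp_m !(rs_re_conj hK).
apply: (@le_lt_trans _ _ (e / 2)%:E); last by rewrite lte_fin; lra.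
apply: (opnorm_dual_le hK) => a x a1 x1.
have [->|k0] := eqVneq (D a x - d a x) 0; first by rewrite normr0 (re0 hK) ltW.
set k := D a x - d a x in k0 *.
pose u := `|k| / k.
have uk : D a (u *: x) - d a (u *: x) = `|k|.
  have DZ (f : E -> K) (v : K) y : scalar f -> f (v *: y) = v * f y.
    move=> lf; have f0 : f 0 = 0.
      by have := lf (-1) 0 0; rewrite scaleN1r oppr0 add0r mulN1r addNr.
    by have := lf v y 0; rewrite f0 !addr0.
  by rewrite !DZ //; [rewrite -mulrBr divfK | case: (tder_dual dd a)].
have nu : rnorm re (u *: x) = rnorm re x.
  rewrite (rnormZ hK) /u normrM normr_id normfV divff ?normr_eq0 //.
  by rewrite -(rmorph1 iota) (rs_reK hK) mul1r.
have := H a (u *: x); rewrite -re_d /beta -(reB hK) uk nu => h.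
rewrite (le_trans (ler_norm _)) // (le_trans h) //.
by rewrite -mulrA ler_piMr ?(ltW e2) // mulr_ile1 ?(rnorm_ge0 hK).
Qed.

End Embedding.

Theorem theorem6p7 (R : realType) :
  (forall (E : completeNormedModType R[i]) (tp : E -> E -> E -> E),
     is_JBstar_triple tp -> is_commutative_triple tp ->
     almost_ternary_weakly_amenable (@complex.Re R) (@conjc R) tp)
  /\
  (forall (E : normedModType R) (tp : E -> E -> E -> E),
     is_real_JBstar_triple tp -> is_commutative_triple tp ->
     almost_ternary_weakly_amenable (@idfun R) (@idfun R) tp).
Proof.
split=> [E tp hE hc|E tp [hE [F [tF [j [hF hj hjn hjt hjc]]]]] hc].
  apply: (almost_ternary_weakly_amenable_embedded (real_scalars_complex R)
    (JBstar_jordan_banach hE) hc hE (j := id)) => //.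
apply: (almost_ternary_weakly_amenable_embedded (real_scalars_real R)
  hE hc hF hj) => //.
by move=> x; rewrite /rnorm hjn.
Qed.
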